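(* The calculus $LS_{BBI}+LS_{ST}$ is sound and cut-free complete with respect to the class of BBI Kripke relational frames satisfying separation theory: for every formula $F$, (i) if $\emptyset;\emptyset\vdash w:F$ is derivable in this calculus (possibly with cut) for some label $w$, then $F$ is valid over this class; and (ii) if $F$ is valid over this class, then $\emptyset;\emptyset\vdash w:F$ is derivable in this calculus without cut for some label variable $w$.
   Context: Formulae: $A ::= p \mid \top\mid\bot\mid\neg A\mid A\vee A\mid A\wedge A\mid A\to A\mid \top^*\mid A*A\mid A\mathrel{-\!\!*}A$, $p\in Var$. Semantics. A BBI Kripke relational frame is $(H,R,\epsilon)$, $H$ nonempty, $R\subseteq H^3$, $\epsilon\in H$, with (identity) $R(h_1,\epsilon,h_2)\iff h_1=h_2$; (commutativity) $R(h_1,h_2,h_3)\iff R(h_2,h_1,h_3)$; (associativity) $R(h_1,h_5,h_4)\wedge R(h_2,h_3,h_5)\Rightarrow\exists h_6\,(R(h_6,h_3,h_4)\wedge R(h_1,h_2,h_6))$. It satisfies separation theory if moreover: (cancellativity) $R(h_1,h_2,h_3)\wedge R(h_1,h_4,h_3)\Rightarrow h_2=h_4$; (partial-determinism) $R(h_1,h_2,h_3)\wedge R(h_1,h_2,h_4)\Rightarrow h_3=h_4$; (indivisible unit) $R(h_1,h_2,\epsilon)\Rightarrow h_1=\epsilon$; (disjointness) $R(h_1,h_1,h_2)\Rightarrow h_1=\epsilon$; (splittability) every $h_0\neq\epsilon$ has $h_1\neq\epsilon,h_2\neq\epsilon$ with $R(h_1,h_2,h_0)$; (cross-split) $R(h_1,h_2,h_0)\wedge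 R(h_3,h_4,h_0)$ implies there are $h_{13},h_{14},h_{23},h_{24}$ with $R(h_{13},h_{14},h_1)$, $R(h_{23},h_{24},h_2)$, $R(h_{13},h_{23},h_3)$, $R(h_{14},h_{24},h_4)$. A model adds $\nu:Var\to\mathcal{P}(H)$; forcing: $h\Vdash p$ iff $h\in\nu(p)$; $\top$ always, $\bot$ never; $\neg,\wedge,\vee,\to$ classical; $h\Vdash\top^*$ iff $h=\epsilon$; $h\Vdash A*B$ iff $\exists h_1,h_2$ with $R(h_1,h_2,h)$, $h_1\Vdash A$, $h_2\Vdash B$; $h\Vdash A\mathrel{-\!\!*}B$ iff $\forall h_1,h_2$, $R(h,h_1,h_2)$ and $h_1\Vdash A$ imply $h_2\Vdash B$. Valid over a class = forced at every world of every model on a frame in the class. Calculus. Labels: $LVar\cup\{\epsilon\}$. Labelled formula $a:A$; relational atom $(a,b\triangleright c)$; inequality $(a\neq b)$. Sequent $\mathcal{G};\Gamma\vdash\Delta$, $\mathcal{G}$ a set of relational atoms and inequalities, $\Gamma,\Delta$ multisets of labelled formulae; $[y/x]$ ($x$ label variable) uniform replacement; $\neg A:=A\to\bot$, $A\vee B:=\neg A\to B$. $LS_{BBI}$ rules (fresh = label variable not in conclusion): $id$: axiom $\mathcal{G};\Gamma,w:p\vdash w:p,\Delta$; $cut$: $\mathcal{G};\Gamma\vdash x:A,\Delta$ and $\mathcal{G}';\Gamma',x:A\vdash\Delta'\Rightarrow\mathcal{G},\mathcal{G}';\Gamma,\Gamma'\vdash\Delta,\Delta'$; $\bot L$: axiom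 $\mathcal{G};\Gamma,w:\bot\vdash\Delta$; $\top R$: axiom $\mathcal{G};\Gamma\vdash w:\top,\Delta$; $\top^*R$: axiom $\mathcal{G};\Gamma\vdash\epsilon:\top^*,\Delta$; $\top^*L$: $(\epsilon,w\triangleright\epsilon),\mathcal{G};\Gamma\vdash\Delta\Rightarrow\mathcal{G};\Gamma,w:\top^*\vdash\Delta$; $\wedge L$: $\mathcal{G};\Gamma,w:A,w:B\vdash\Delta\Rightarrow\mathcal{G};\Gamma,w:A\wedge B\vdash\Delta$; $\wedge R$: $\mathcal{G};\Gamma\vdash w:A,\Delta$ and $\mathcal{G};\Gamma\vdash w:B,\Delta\Rightarrow\mathcal{G};\Gamma\vdash w:A\wedge B,\Delta$; $\to L$: $\mathcal{G};\Gamma\vdash w:A,\Delta$ and $\mathcal{G};\Gamma,w:B\vdash\Delta\Rightarrow\mathcal{G};\Gamma,w:A\to B\vdash\Delta$; $\to R$: $\mathcal{G};\Gamma,w:A\vdash w:B,\Delta\Rightarrow\mathcal{G};\Gamma\vdash w:A\to B,\Delta$; $*L$: $(x,y\triangleright z),\mathcal{G};\Gamma,x:A,y:B\vdash\Delta\Rightarrow\mathcal{G};\Gamma,z:A*B\vdash\Delta$ ($x,y$ fresh); $\mathrel{-\!\!*}R$: $(x,z\triangleright y),\mathcal{G};\Gamma,x:A\vdash y:B,\Delta\Rightarrow\mathcal{G};\Gamma\vdash z:A\mathrel{-\!\!*}B,\Delta$ ($x,y$ fresh); $*R$: $(x,y\triangleright z),\mathcal{G};\Gamma\vdash x:A,z:A*B,\Delta$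 and $(x,y\triangleright z),\mathcal{G};\Gamma\vdash y:B,z:A*B,\Delta\Rightarrow(x,y\triangleright z),\mathcal{G};\Gamma\vdash z:A*B,\Delta$; $\mathrel{-\!\!*}L$: $(x,y\triangleright z),\mathcal{G};\Gamma,y:A\mathrel{-\!\!*}B\vdash x:A,\Delta$ and $(x,y\triangleright z),\mathcal{G};\Gamma,y:A\mathrel{-\!\!*}B,z:B\vdash\Delta\Rightarrow(x,y\triangleright z),\mathcal{G};\Gamma,y:A\mathrel{-\!\!*}B\vdash\Delta$; $E$: $(y,x\triangleright z),(x,y\triangleright z),\mathcal{G};\Gamma\vdash\Delta\Rightarrow(x,y\triangleright z),\mathcal{G};\Gamma\vdash\Delta$; $A$: $(u,w\triangleright z),(y,v\triangleright w),(x,y\triangleright z),(u,v\triangleright x),\mathcal{G};\Gamma\vdash\Delta\Rightarrow(x,y\triangleright z),(u,v\triangleright x),\mathcal{G};\Gamma\vdash\Delta$ ($w$ fresh); $U$: $(x,\epsilon\triangleright x),\mathcal{G};\Gamma\vdash\Delta\Rightarrow\mathcal{G};\Gamma\vdash\Delta$; $A_C$: $(x,w\triangleright x),(y,y\triangleright w),(x,y\triangleright x),\mathcal{G};\Gamma\vdash\Delta\Rightarrow(x,y\triangleright x),\mathcal{G};\Gamma\vdash\Delta$ ($w$ fresh); $Eq_1$: $(\epsilon,w'\triangleright w'),\mathcal{G}[w'/w];\Gamma[w'/w]\vdash\Delta[w'/w]\Rightarrow(\epsilon,w\triangleright w'),\mathcal{G};\Gamma\vdash\Delta$; $Eq_2$: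 same premise $\Rightarrow(\epsilon,w'\triangleright w),\mathcal{G};\Gamma\vdash\Delta$. $LS_{ST}$ is the set of rules: $P$: $(x,y\triangleright z),\mathcal{G}[z/w];\Gamma[z/w]\vdash\Delta[z/w]\Rightarrow(x,y\triangleright z),(x,y\triangleright w),\mathcal{G};\Gamma\vdash\Delta$; $C$: $(x,y\triangleright z),\mathcal{G}[y/w];\Gamma[y/w]\vdash\Delta[y/w]\Rightarrow(x,y\triangleright z),(x,w\triangleright z),\mathcal{G};\Gamma\vdash\Delta$; $IU$: $(\epsilon,y\triangleright\epsilon),\mathcal{G}[\epsilon/x];\Gamma[\epsilon/x]\vdash\Delta[\epsilon/x]\Rightarrow(x,y\triangleright\epsilon),\mathcal{G};\Gamma\vdash\Delta$; $D$: $(\epsilon,\epsilon\triangleright y),\mathcal{G}[\epsilon/x];\Gamma[\epsilon/x]\vdash\Delta[\epsilon/x]\Rightarrow(x,x\triangleright y),\mathcal{G};\Gamma\vdash\Delta$; $S$: $(x,y\triangleright z),(x\neq\epsilon),(y\neq\epsilon),(z\neq\epsilon),\mathcal{G};\Gamma\vdash\Delta\Rightarrow(z\neq\epsilon),\mathcal{G};\Gamma\vdash\Delta$ ($x,y$ fresh); $\neq L$: axiom $(w\neq w),\mathcal{G};\Gamma\vdash\Delta$; $EM$: $(w\neq\epsilon),\mathcal{G};\Gamma\vdash\Delta$ and $(\epsilon,w\triangleright\epsilon),\mathcal{G};\Gamma\vdash\Delta\Rightarrow\mathcal{G};\Gamma\vdash\Delta$; $CS$: $(p,q\triangleright x),(p,s\triangleright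 u),(s,t\triangleright y),(q,t\triangleright v),(x,y\triangleright z),(u,v\triangleright z),\mathcal{G};\Gamma\vdash\Delta\Rightarrow(x,y\triangleright z),(u,v\triangleright z),\mathcal{G};\Gamma\vdash\Delta$ ($p,q,s,t$ fresh); $CS_C$: $(p,q\triangleright x),(p,s\triangleright x),(s,t\triangleright y),(q,t\triangleright y),(x,y\triangleright z),\mathcal{G};\Gamma\vdash\Delta\Rightarrow(x,y\triangleright z),\mathcal{G};\Gamma\vdash\Delta$ ($p,q,s,t$ fresh). In every rule with a substitution $[\cdot/x]$ or $[\cdot/w]$, the replaced label must be a label variable.
   Formalization: In (i), ''for some label w'' is read as ''for some label variable w'': with w = ε the claim fails, since the axiom ⊤*R derives ∅;∅ ⊢ ε:⊤* while ⊤* is not valid over the class. *)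

(* Defs.v *)
From Stdlib Require Import List Permutation Arith.
Import ListNotations.

Set Implicit Arguments.

Inductive formula (Var : Type) : Type :=
| FVar (p : Var)
| FTop
| FBot
| FNot (A : formula Var)
| FOr (A B : formula Var)
| FAnd (A B : formula Var)
| FImp (A B : formula Var)
| FEmp
| FStar (A B : formula Var)
| FWand (A B : formula Var).

Arguments FTop {Var}.
Arguments FBot {Var}.
Arguments FEmp {Var}.

(* The calculus has no rules for negation and disjunction, which it treats as
   abbreviations: [~A := A -> Bot] and [A \/ B := ~A -> B]. *)
Fixpoint unabbrev (Var : Type) (A : formula Var) : formula Var :=
  match A with
  | FVar p => FVar p
  | FTop => FTop
  | FBot => FBot
  | FNot A => FImp (unabbrev A) FBot
  | FOr A B => FImp (FImp (unabbrev A) FBot) (unabbrev B)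
  | FAnd A B => FAnd (unabbrev A) (unabbrev B)
  | FImp A B => FImp (unabbrev A) (unabbrev B)
  | FEmp => FEmp
  | FStar A B => FStar (unabbrev A) (unabbrev B)
  | FWand A B => FWand (unabbrev A) (unabbrev B)
  end.

(* The carrier is nonempty because it contains [eps]. *)
Record bbi_frame : Type := {
  world :> Type;
  R : world -> world -> world -> Prop;
  eps : world;
  frame_identity : forall h1 h2, R h1 eps h2 <-> h1 = h2;
  frame_commutativity : forall h1 h2 h3, R h1 h2 h3 <-> R h2 h1 h3;
  frame_associativity : forall h1 h2 h3 h4 h5,
    R h1 h5 h4 -> R h2 h3 h5 -> exists h6, R h6 h3 h4 /\ R h1 h2 h6
}.

Arguments R {_} _ _ _.
Arguments eps {_}.

Definition cancellativity (M : bbi_frame) : Prop :=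
  forall h1 h2 h3 h4 : M, R h1 h2 h3 -> R h1 h4 h3 -> h2 = h4.

Definition partial_determinism (M : bbi_frame) : Prop :=
  forall h1 h2 h3 h4 : M, R h1 h2 h3 -> R h1 h2 h4 -> h3 = h4.

Definition indivisible_unit (M : bbi_frame) : Prop :=
  forall h1 h2 : M, R h1 h2 eps -> h1 = eps.

Definition disjointness (M : bbi_frame) : Prop :=
  forall h1 h2 : M, R h1 h1 h2 -> h1 = eps.

Definition splittability (M : bbi_frame) : Prop :=
  forall h0 : M, h0 <> eps ->
    exists h1 h2 : M, h1 <> eps /\ h2 <> eps /\ R h1 h2 h0.

Definition cross_split (M : bbi_frame) : Prop :=
  forall h0 h1 h2 h3 h4 : M, R h1 h2 h0 -> R h3 h4 h0 ->
    exists h13 h14 h23 h24 : M,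
      R h13 h14 h1 /\ R h23 h24 h2 /\ R h13 h23 h3 /\ R h14 h24 h4.

Definition separation_theory (M : bbi_frame) : Prop :=
  cancellativity M /\ partial_determinism M /\ indivisible_unit M /\
  disjointness M /\ splittability M /\ cross_split M.

Fixpoint forces (Var : Type) (M : bbi_frame) (nu : Var -> M -> Prop)
    (h : M) (A : formula Var) : Prop :=
  match A with
  | FVar p => nu p h
  | FTop => True
  | FBot => False
  | FNot A => ~ forces M nu h A
  | FOr A B => forces M nu h A \/ forces M nu h B
  | FAnd A B => forces M nu h A /\ forces M nu h B
  | FImp A B => forces M nu h A -> forces M nu h B
  | FEmp => h = eps
  | FStar A B =>
      exists h1 h2 : M, R h1 h2 h /\ forces M nu h1 A /\ forces M nu h2 B
  | FWand A B =>
      forall h1 h2 : M, R h h1 h2 -> forces M nu h1 A -> forces M nu h2 B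
  end.

Definition valid_over (C : bbi_frame -> Prop) (Var : Type)
    (A : formula Var) : Prop :=
  forall M : bbi_frame, C M ->
  forall (nu : Var -> M -> Prop) (h : M), forces M nu h A.

Definition lvar : Set := nat.

Inductive label : Set :=
| Eps
| LV (x : lvar).

Inductive constr : Set :=
| Rel (a b c : label)
| Neq (a b : label).

Definition lformula (Var : Type) : Type := (label * formula Var)%type.

(* [y/x] *)
Definition subst_label (y : label) (x : lvar) (a : label) : label :=
  match a with
  | Eps => Eps
  | LV n => if Nat.eqb n x then y else LV n
  end.

Definition subst_constr (y : label) (x : lvar) (r : constr) : constr :=
  match r with
  | Rel a b c =>
      Rel (subst_label y x a) (subst_label y x b) (subst_label y x c)
  | Neq a b => Neq (subst_label y x a) (subst_label y x b)
  end.

Definition substG (y : label) (x : lvar) (G : list constr) : list constr :=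
  map (subst_constr y x) G.

Definition substL (Var : Type) (y : label) (x : lvar)
    (Gam : list (lformula Var)) : list (lformula Var) :=
  map (fun aA => (subst_label y x (fst aA), snd aA)) Gam.

Definition constr_labels (r : constr) : list label :=
  match r with
  | Rel a b c => [a; b; c]
  | Neq a b => [a; b]
  end.

Definition fresh (Var : Type) (x : lvar) (G : list constr)
    (Gam Del : list (lformula Var)) : Prop :=
  ~ In (LV x) (flat_map constr_labels G ++ map fst Gam ++ map fst Del).

(* [derivable cut G Gam Del]: the sequent G; Gam |- Del is derivable, with the
   cut rule available iff [cut = true].  [d_conv] makes the first list a finite
   set and the other two finite multisets.  Several fresh label variables in
   one rule are pairwise distinct.  As usual with sets, the principal
   constraints of a rule may also occur in its context [G], and two principal
   constraints may coincide. *)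
Inductive derivable (Var : Type) (cut : bool) :
  list constr -> list (lformula Var) -> list (lformula Var) -> Prop :=
| d_conv G G' Gam Gam' Del Del' :
    (forall r, In r G <-> In r G') ->
    Permutation Gam Gam' -> Permutation Del Del' ->
    derivable cut G Gam Del ->
    derivable cut G' Gam' Del'

| d_id G Gam Del w p :
    derivable cut G ((w, FVar p) :: Gam) ((w, FVar p) :: Del)
| d_cut G G' Gam Gam' Del Del' x A :
    cut = true ->
    derivable cut G Gam ((x, A) :: Del) ->
    derivable cut G' ((x, A) :: Gam') Del' ->
    derivable cut (G ++ G') (Gam ++ Gam') (Del ++ Del')
| d_botL G Gam Del w :
    derivable cut G ((w, FBot) :: Gam) Del
| d_topR G Gam Del w :
    derivable cut G Gam ((w, FTop) :: Del)
| d_empR G Gam Del :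
    derivable cut G Gam ((Eps, FEmp) :: Del)
| d_empL G Gam Del w :
    derivable cut (Rel Eps w Eps :: G) Gam Del ->
    derivable cut G ((w, FEmp) :: Gam) Del
| d_andL G Gam Del w A B :
    derivable cut G ((w, A) :: (w, B) :: Gam) Del ->
    derivable cut G ((w, FAnd A B) :: Gam) Del
| d_andR G Gam Del w A B :
    derivable cut G Gam ((w, A) :: Del) ->
    derivable cut G Gam ((w, B) :: Del) ->
    derivable cut G Gam ((w, FAnd A B) :: Del)
| d_impL G Gam Del w A B :
    derivable cut G Gam ((w, A) :: Del) ->
    derivable cut G ((w, B) :: Gam) Del ->
    derivable cut G ((w, FImp A B) :: Gam) Del
| d_impR G Gam Del w A B :
    derivable cut G ((w, A) :: Gam) ((w, B) :: Del) ->
    derivable cut G Gam ((w, FImp A B) :: Del)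
| d_starL G Gam Del x y z A B :
    NoDup [x; y] ->
    (forall n, In n [x; y] -> fresh n G ((z, FStar A B) :: Gam) Del) ->
    derivable cut (Rel (LV x) (LV y) z :: G)
      ((LV x, A) :: (LV y, B) :: Gam) Del ->
    derivable cut G ((z, FStar A B) :: Gam) Del
| d_wandR G Gam Del x y z A B :
    NoDup [x; y] ->
    (forall n, In n [x; y] -> fresh n G Gam ((z, FWand A B) :: Del)) ->
    derivable cut (Rel (LV x) z (LV y) :: G)
      ((LV x, A) :: Gam) ((LV y, B) :: Del) ->
    derivable cut G Gam ((z, FWand A B) :: Del)
| d_starR G Gam Del x y z A B :
    derivable cut (Rel x y z :: G) Gam ((x, A) :: (z, FStar A B) :: Del) ->
    derivable cut (Rel x y z :: G) Gam ((y, B) :: (z, FStar A B) :: Del) ->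
    derivable cut (Rel x y z :: G) Gam ((z, FStar A B) :: Del)
| d_wandL G Gam Del x y z A B :
    derivable cut (Rel x y z :: G) ((y, FWand A B) :: Gam) ((x, A) :: Del) ->
    derivable cut (Rel x y z :: G) ((y, FWand A B) :: (z, B) :: Gam) Del ->
    derivable cut (Rel x y z :: G) ((y, FWand A B) :: Gam) Del

| d_E G Gam Del x y z :
    derivable cut (Rel y x z :: Rel x y z :: G) Gam Del ->
    derivable cut (Rel x y z :: G) Gam Del
| d_A G Gam Del x y z u v w :
    fresh w (Rel x y z :: Rel u v x :: G) Gam Del ->
    derivable cut
      (Rel u (LV w) z :: Rel y v (LV w) :: Rel x y z :: Rel u v x :: G)
      Gam Del ->
    derivable cut (Rel x y z :: Rel u v x :: G) Gam Del
| d_U G Gam Del x :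
    derivable cut (Rel x Eps x :: G) Gam Del ->
    derivable cut G Gam Del
| d_AC G Gam Del x y w :
    fresh w (Rel x y x :: G) Gam Del ->
    derivable cut (Rel x (LV w) x :: Rel y y (LV w) :: Rel x y x :: G)
      Gam Del ->
    derivable cut (Rel x y x :: G) Gam Del
| d_Eq1 G Gam Del w w' :
    derivable cut (Rel Eps w' w' :: substG w' w G)
      (substL w' w Gam) (substL w' w Del) ->
    derivable cut (Rel Eps (LV w) w' :: G) Gam Del
| d_Eq2 G Gam Del w w' :
    derivable cut (Rel Eps w' w' :: substG w' w G)
      (substL w' w Gam) (substL w' w Del) ->
    derivable cut (Rel Eps w' (LV w) :: G) Gam Del

| d_P G Gam Del x y z w :
    derivable cut (Rel x y z :: substG z w G)
      (substL z w Gam) (substL z w Del) ->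
    derivable cut (Rel x y z :: Rel x y (LV w) :: G) Gam Del
| d_C G Gam Del x y z w :
    derivable cut (Rel x y z :: substG y w G)
      (substL y w Gam) (substL y w Del) ->
    derivable cut (Rel x y z :: Rel x (LV w) z :: G) Gam Del
| d_IU G Gam Del x y :
    derivable cut (Rel Eps y Eps :: substG Eps x G)
      (substL Eps x Gam) (substL Eps x Del) ->
    derivable cut (Rel (LV x) y Eps :: G) Gam Del
| d_D G Gam Del x y :
    derivable cut (Rel Eps Eps y :: substG Eps x G)
      (substL Eps x Gam) (substL Eps x Del) ->
    derivable cut (Rel (LV x) (LV x) y :: G) Gam Del
| d_S G Gam Del x y z :
    NoDup [x; y] ->
    (forall n, In n [x; y] -> fresh n (Neq z Eps :: G) Gam Del) ->
    derivable cut
      (Rel (LV x) (LV y) z :: Neq (LV x) Eps :: Neq (LV y) Eps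
        :: Neq z Eps :: G) Gam Del ->
    derivable cut (Neq z Eps :: G) Gam Del
| d_neqL G Gam Del w :
    derivable cut (Neq w w :: G) Gam Del
| d_EM G Gam Del w :
    derivable cut (Neq w Eps :: G) Gam Del ->
    derivable cut (Rel Eps w Eps :: G) Gam Del ->
    derivable cut G Gam Del
| d_CS G Gam Del x y z u v p q s t :
    NoDup [p; q; s; t] ->
    (forall n, In n [p; q; s; t] ->
      fresh n (Rel x y z :: Rel u v z :: G) Gam Del) ->
    derivable cut
      (Rel (LV p) (LV q) x :: Rel (LV p) (LV s) u :: Rel (LV s) (LV t) y
        :: Rel (LV q) (LV t) v :: Rel x y z :: Rel u v z :: G) Gam Del ->
    derivable cut (Rel x y z :: Rel u v z :: G) Gam Del
| d_CSC G Gam Del x y z p q s t :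
    NoDup [p; q; s; t] ->
    (forall n, In n [p; q; s; t] -> fresh n (Rel x y z :: G) Gam Del) ->
    derivable cut
      (Rel (LV p) (LV q) x :: Rel (LV p) (LV s) x :: Rel (LV s) (LV t) y
        :: Rel (LV q) (LV t) y :: Rel x y z :: G) Gam Del ->
    derivable cut (Rel x y z :: G) Gam Del.

(* Main.v *)
Require Import Defs.
From Stdlib Require Import List Permutation Arith Lia.
From Stdlib Require Import Classical ClassicalEpsilon FunctionalExtensionality
  PropExtensionality.
Import ListNotations.

(* Soundness is a rule-by-rule check.  For completeness, assume that
   [ |- w : F ] has no cut-free derivation and search backwards for one: an
   underivable sequent always has an underivable premise for each rule
   application.  In one round, every rule instance available at the current
   sequent is handled; iterating yields a sequence of sequents connected by maps
   of labels, because the rules with a substitution merge two labels and the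
   other rules only add labels.  The direct limit of the labels along these
   maps, with the relational atoms that occur eventually, is a frame satisfying
   separation theory: each frame axiom is enforced by one structural rule.
   Splittability uses [EM], which decides whether a label is [eps], followed by
   [S].  Formulae that occur on the left of some sequent hold in this model,
   those on the right fail, hence [F] fails.  No weakening or contraction
   of formulae is needed: a branch remembers the consumed formulae. *)

Set Implicit Arguments.

(** * Soundness *)

Section Soundness.

Context {Var : Type} {M : bbi_frame} (nu : Var -> M -> Prop).

Definition val (rho : lvar -> M) (a : label) : M :=
  match a with Eps => eps | LV n => rho n end.

Definition csat (rho : lvar -> M) (r : constr) : Prop :=
  match r with
  | Rel a b c => R (val rho a) (val rho b) (val rho c)
  | Neq a b => val rho a <> val rho b
  end.

Definition lsat (rho : lvar -> M) (aA : lformula Var) : Prop :=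
  forces M nu (val rho (fst aA)) (snd aA).

Definition seq_sat (rho : lvar -> M) G Gam Del : Prop :=
  Forall (csat rho) G -> Forall (lsat rho) Gam -> Exists (lsat rho) Del.

(** Rules with fresh labels need one, two or four label variables revalued at once; distinctness
    keeps the updates from overwriting one another. *)
Lemma exists_valuation (rho : lvar -> M) (ns : list lvar) (hs : list M) :
  NoDup ns -> length ns = length hs ->
  exists rho' : lvar -> M,
    map rho' ns = hs /\ forall m, ~ In m ns -> rho' m = rho m.
Proof.
  intros Hnd. revert hs. induction Hnd as [|n ns Hn Hnd IH]; intros [|h hs] Hl;
    try discriminate.
  - now exists rho.
  - injection Hl as Hl. destruct (IH hs Hl) as (rho' & Hmap & Hout).
    exists (fun m => if Nat.eqb m n then h else rho' m). split.
    + simpl. rewrite Nat.eqb_refl. f_equal. rewrite <- Hmap.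
      apply map_ext_in. intros m Hm.
      destruct (Nat.eqb_spec m n) as [->|]; [contradiction|reflexivity].
    + intros m Hm. destruct (Nat.eqb_spec m n) as [->|].
      * destruct Hm. now left.
      * apply Hout. intro. apply Hm. now right.
Qed.

(** The labels of the sequent avoid [ns], so their values do not change. The directions are those of
    a soundness step: hypotheses pass from [rho] to [rho'], and the conclusion found under [rho']
    passes back. *)
Lemma seq_sat_agree (rho rho' : lvar -> M) (ns : list lvar) G Gam Del :
  (forall n, In n ns -> fresh n G Gam Del) ->
  (forall m, ~ In m ns -> rho' m = rho m) ->
  (forall a, In a (flat_map constr_labels G ++ map fst Gam ++ map fst Del) ->
    val rho' a = val rho a) /\
  (Forall (csat rho) G -> Forall (csat rho') G) /\
  (Forall (lsat rho) Gam -> Forall (lsat rho') Gam) /\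
  (Exists (lsat rho') Del -> Exists (lsat rho) Del).
Proof.
  intros Hfr Hout.
  assert (Hag : forall a,
    In a (flat_map constr_labels G ++ map fst Gam ++ map fst Del) ->
    val rho' a = val rho a).
  { intros [|n] Hn; simpl; [reflexivity|]. apply Hout.
    intro Hin. now apply (Hfr n Hin). }
  split; [exact Hag|]. repeat split.
  - rewrite !Forall_forall. intros HG r Hr.
    assert (Hl : forall a, In a (constr_labels r) -> val rho' a = val rho a).
    { intros a Ha. apply Hag, in_or_app. left. apply in_flat_map. eauto. }
    specialize (HG r Hr). destruct r; simpl in *; now rewrite !Hl by auto.
  - rewrite !Forall_forall. intros HG f Hf. unfold lsat.
    rewrite Hag; [exact (HG f Hf)|].
    apply in_or_app. right. apply in_or_app. left. now apply in_map.
  - rewrite !Exists_exists. intros (f & Hf & Hs).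
    exists f. split; [exact Hf|]. unfold lsat in *. rewrite Hag in Hs; [exact Hs|].
    apply in_or_app. right. apply in_or_app. right. now apply in_map.
Qed.

Lemma val_subst (rho : lvar -> M) y x a :
  val rho y = rho x -> val rho (subst_label y x a) = val rho a.
Proof.
  intros H. destruct a as [|n]; simpl; [reflexivity|].
  destruct (Nat.eqb_spec n x) as [->|]; auto.
Qed.

(** A valuation that already identifies [y] and [x] cannot see the substitution. For a rule that
    merges labels it thus remains to obtain the identification from a frame axiom. *)
Lemma seq_sat_subst (rho : lvar -> M) y x G Gam Del :
  val rho y = rho x ->
  seq_sat rho (substG y x G) (substL y x Gam) (substL y x Del) ->
  seq_sat rho G Gam Del.
Proof.
  intros H HS HG HGam.
  assert (HD : Exists (lsat rho) (substL y x Del)).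
  { apply HS.
    - apply Forall_map. eapply Forall_impl; [|exact HG].
      intros [a b c|a b]; simpl; now rewrite !val_subst.
    - apply Forall_map. eapply Forall_impl; [|exact HGam].
      intros [a A]; unfold lsat; simpl. now rewrite !val_subst. }
  apply Exists_exists in HD. destruct HD as (f & Hf & Hs).
  apply in_map_iff in Hf. destruct Hf as ((a, A) & <- & Ha).
  apply Exists_exists. exists (a, A). split; [exact Ha|].
  unfold lsat in *. simpl in *. now rewrite val_subst in Hs.
Qed.

End Soundness.

Lemma frame_unit_l (M : bbi_frame) (h1 h2 : M) : R eps h1 h2 <-> h1 = h2.
Proof. rewrite frame_commutativity. apply frame_identity. Qed.

(** Associativity in the shape of rule $A$, with commutativity applied before and after. *)
Lemma frame_assoc_comm (M : bbi_frame) (x y z u v : M) :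
  R x y z -> R u v x -> exists w, R u w z /\ R y v w.
Proof.
  intros H1 H2. apply (frame_commutativity M) in H1, H2.
  destruct (frame_associativity M _ _ _ _ _ H1 H2) as (w & Hw1 & Hw2).
  exists w. split; [now apply frame_commutativity|exact Hw2].
Qed.

Ltac forall_inv :=
  repeat match goal with
  | H : Forall _ (_ :: _) |- _ =>
      let H1 := fresh "Hh" in let H2 := fresh "Ht" in
      pose proof (Forall_inv H) as H1; pose proof (Forall_inv_tail H) as H2;
      clear H; simpl in H1
  end.

Ltac interpret nu rho ns hs :=
  match goal with
  | Hnd : NoDup ns, Hfr : forall n, In n ns -> fresh n _ _ _ |- _ =>
      destruct (@exists_valuation _ rho ns hs Hnd eq_refl) as (rho' & Hmap & Hout);
      destruct (seq_sat_agree nu rho rho' ns Hfr Hout)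
        as (Hlab & HGtr & HGamtr & HDeltr);
      injection Hmap as; try (apply HDeltr)
  end.

Ltac label_in := simpl; repeat rewrite in_app_iff; simpl; tauto.

(** Induction on the derivation with [rho] left general, because rules with fresh labels use the
    induction hypothesis at a modified valuation. *)
Lemma soundness (Var : Type) (M : bbi_frame) (nu : Var -> M -> Prop)
    (cut : bool) G Gam Del :
  separation_theory M -> derivable cut G Gam Del ->
  forall rho, seq_sat nu rho G Gam Del.
Proof.
  intros (Hcanc & Hdet & Hiu & Hdisj & Hsplit & Hcs) Hd.
  induction Hd; intros rho HG HGam.
  - rewrite <- H1. apply IHHd.
    + rewrite Forall_forall in *. firstorder.
    + now rewrite H0.
  - forall_inv. now left.
  - apply Forall_app in HG, HGam. apply Exists_app.
    destruct HG as (HG1 & HG2), HGam as (HGam1 & HGam2).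
    specialize (IHHd1 rho HG1 HGam1). apply Exists_cons in IHHd1.
    destruct IHHd1 as [HA|]; [|now left].
    right. apply (IHHd2 rho); [assumption|now constructor].
  - forall_inv. destruct Hh.
  - now left.
  - now left.
  - forall_inv. apply (IHHd rho); [|assumption].
    constructor; [|assumption]. now apply frame_unit_l.
  - forall_inv. destruct Hh. apply (IHHd rho); [assumption|].
    now apply Forall_cons; [|apply Forall_cons].
  - specialize (IHHd1 rho HG HGam). specialize (IHHd2 rho HG HGam).
    apply Exists_cons in IHHd1, IHHd2. apply Exists_cons.
    unfold lsat in *; simpl in *. tauto.
  - forall_inv. specialize (IHHd1 rho HG Ht). apply Exists_cons in IHHd1.
    destruct IHHd1 as [HA|]; [|assumption].
    apply (IHHd2 rho HG). constructor; [now apply Hh|assumption].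
  - apply Exists_cons.
    (* If some formula of [Del] already holds, nothing is left to prove; otherwise the premise can
       only yield [B]. *)
    destruct (classic (Exists (lsat nu rho) Del)) as [|HnD]; [now right|].
    left. intro HA. assert (HE : Exists (lsat nu rho) ((w, B) :: Del)).
    { apply (IHHd rho HG). now constructor. }
    apply Exists_cons in HE. destruct HE; [assumption|contradiction].
  - destruct (Forall_inv HGam) as (h1 & h2 & HR & HA & HB).
    interpret nu rho [x; y] [h1; h2].
    specialize (HGtr HG). specialize (HGamtr HGam). forall_inv.
    assert (Hz : val rho' z = val rho z) by (apply Hlab; label_in).
    apply (IHHd rho').
    + constructor; [|assumption]. simpl. now rewrite H1, H2, Hz.
    + apply Forall_cons; [|apply Forall_cons; [|assumption]];
        unfold lsat; simpl; now rewrite ?H1, ?H2.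
  - apply Exists_cons.
    destruct (classic (Exists (lsat nu rho) Del)) as [|HnD]; [now right|].
    left. intros h1 h2 HR HA. simpl in HR.
    (* The fresh labels denote the arbitrary worlds [h1] and [h2] of the forcing clause for the
       wand. *)
    interpret nu rho [x; y] [h1; h2].
    assert (Hz : val rho' z = val rho z) by (apply Hlab; label_in).
    assert (HE : Exists (lsat nu rho') ((LV y, B) :: Del)).
    { apply (IHHd rho').
      - constructor; [|auto]. simpl. rewrite H1, H2, Hz.
        now apply frame_commutativity.
      - constructor; [|auto]. unfold lsat. simpl. now rewrite H1. }
    apply Exists_cons in HE. destruct HE as [HE|HE].
    + unfold lsat in HE. simpl in HE. now rewrite H2 in HE.
    + assert (HE' : Exists (lsat nu rho) ((z, FWand A B) :: Del))
        by (apply HDeltr; now right).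
      apply Exists_cons in HE'. destruct HE' as [HE'|]; [|contradiction].
      now apply (HE' h1 h2).
  - pose proof (Forall_inv HG) as HR.
    specialize (IHHd1 rho HG HGam). specialize (IHHd2 rho HG HGam).
    apply Exists_cons in IHHd1, IHHd2.
    destruct IHHd1 as [HA|]; [|assumption].
    destruct IHHd2 as [HB|]; [|assumption].
    left. exists (val rho x), (val rho y). auto.
  - pose proof (Forall_inv HG) as HR. pose proof (Forall_inv HGam) as HW.
    specialize (IHHd1 rho HG HGam). apply Exists_cons in IHHd1.
    destruct IHHd1 as [HA|]; [|assumption].
    apply (IHHd2 rho HG). forall_inv.
    apply Forall_cons; [exact HW|apply Forall_cons; [|assumption]].
    apply (HW (val rho x) (val rho z)); [|exact HA].
    now apply frame_commutativity.

  - apply (IHHd rho); [|assumption]. constructor; [|assumption].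
    pose proof (Forall_inv HG). now apply frame_commutativity.
  - destruct (frame_assoc_comm M _ _ _ _ _ (Forall_inv HG)
      (Forall_inv (Forall_inv_tail HG))) as (h & H1 & H2).
    assert (Hnd : NoDup [w]) by (repeat constructor; auto).
    assert (Hfr : forall n, In n [w] ->
        fresh n (Rel x y z :: Rel u v x :: G) Gam Del)
      by (intros n [<-|[]]; assumption).
    interpret nu rho [w] [h].
    apply (IHHd rho'); [|auto].
    do 2 (apply Forall_cons; [simpl; rewrite H0, !Hlab by label_in; assumption|]).
    auto.
  - apply (IHHd rho); [|assumption]. constructor; [|assumption].
    now apply frame_identity.
  (* Rule $A_C$ is associativity with one atom in both roles. *)
  - destruct (frame_assoc_comm M _ _ _ _ _ (Forall_inv HG)
      (Forall_inv HG)) as (h & H1 & H2).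
    assert (Hnd : NoDup [w]) by (repeat constructor; auto).
    assert (Hfr : forall n, In n [w] -> fresh n (Rel x y x :: G) Gam Del)
      by (intros n [<-|[]]; assumption).
    interpret nu rho [w] [h].
    apply (IHHd rho'); [|auto].
    do 2 (apply Forall_cons; [simpl; rewrite H0, !Hlab by label_in; assumption|]).
    auto.
  - forall_inv. apply frame_unit_l in Hh.
    apply (@seq_sat_subst _ _ nu rho w' w G Gam Del (eq_sym Hh)); [|assumption..].
    intros HG' HGam'. apply (IHHd rho); [|assumption].
    constructor; [|assumption]. now apply frame_unit_l.
  - forall_inv. apply frame_unit_l in Hh.
    apply (@seq_sat_subst _ _ nu rho w' w G Gam Del Hh); [|assumption..].
    intros HG' HGam'. apply (IHHd rho); [|assumption].
    constructor; [|assumption]. now apply frame_unit_l.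
  - forall_inv.
    apply (@seq_sat_subst _ _ nu rho z w G Gam Del
      (Hdet _ _ _ _ Hh Hh0)); [|assumption..].
    intros HG' HGam'. apply (IHHd rho); [|assumption].
    now constructor.
  - forall_inv.
    apply (@seq_sat_subst _ _ nu rho y w G Gam Del
      (Hcanc _ _ _ _ Hh Hh0)); [|assumption..].
    intros HG' HGam'. apply (IHHd rho); [|assumption].
    now constructor.
  - forall_inv. pose proof (Hiu _ _ Hh) as Hx.
    apply (@seq_sat_subst _ _ nu rho Eps x G Gam Del (eq_sym Hx)); [|assumption..].
    intros HG' HGam'. apply (IHHd rho); [|assumption].
    (* Only the first unit stands for [x]; the last one belongs to the principal atom itself. *)
    constructor; [|assumption]. simpl. now rewrite <- Hx at 1.
  - forall_inv. pose proof (Hdisj _ _ Hh) as Hx.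
    apply (@seq_sat_subst _ _ nu rho Eps x G Gam Del (eq_sym Hx)); [|assumption..].
    intros HG' HGam'. apply (IHHd rho); [|assumption].
    constructor; [|assumption]. simpl. now rewrite Hx in Hh.
  - destruct (Hsplit _ (Forall_inv HG)) as (h1 & h2 & Hh1 & Hh2 & HR).
    interpret nu rho [x; y] [h1; h2].
    apply (IHHd rho'); [|auto].
    specialize (HGtr HG).
    constructor; [|constructor; [|constructor; [|assumption]]]; simpl.
    + now rewrite H1, H2, Hlab by label_in.
    + now rewrite H1.
    + now rewrite H2.
  - now pose proof (Forall_inv HG).
  - destruct (classic (val rho w = eps)) as [Hw|Hw].
    + apply (IHHd2 rho); [|assumption]. constructor; [|assumption].
      now apply frame_unit_l.
    + apply (IHHd1 rho); [|assumption]. now constructor.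
  - destruct (Hcs _ _ _ _ _ (Forall_inv HG) (Forall_inv (Forall_inv_tail HG)))
      as (h1 & h2 & h3 & h4 & HR1 & HR2 & HR3 & HR4).
    interpret nu rho [p; q; s; t] [h1; h2; h3; h4].
    apply (IHHd rho'); [|auto]. specialize (HGtr HG).
    do 4 (constructor; [simpl; rewrite ?H1, ?H2, ?H3, ?H4, !Hlab by label_in;
      assumption|]). assumption.
  (* Rule $CS_C$ is the cross-split of an atom against itself. *)
  - destruct (Hcs _ _ _ _ _ (Forall_inv HG) (Forall_inv HG))
      as (h1 & h2 & h3 & h4 & HR1 & HR2 & HR3 & HR4).
    interpret nu rho [p; q; s; t] [h1; h2; h3; h4].
    apply (IHHd rho'); [|auto]. specialize (HGtr HG).
    do 4 (constructor; [simpl; rewrite ?H1, ?H2, ?H3, ?H4, !Hlab by label_in;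
      assumption|]). assumption.
Qed.

(** Negation agrees by unfolding; disjunction agrees only classically, by cases on [A]. *)
Lemma forces_unabbrev (Var : Type) (M : bbi_frame) (nu : Var -> M -> Prop)
    (A : formula Var) :
  forall h, forces M nu h (unabbrev A) <-> forces M nu h A.
Proof.
  induction A as [p| | |A IHA|A IHA B IHB|A IHA B IHB|A IHA B IHB| |A IHA B IHB
    |A IHA B IHB]; intro h; simpl; try tauto.
  - now rewrite IHA.
  - rewrite IHA, IHB. destruct (classic (forces M nu h A)); tauto.
  - now rewrite IHA, IHB.
  - now rewrite IHA, IHB.
  - split; intros (h1 & h2 & HR & HA & HB); exists h1, h2;
      rewrite ?IHA, ?IHB in *; auto.
  - split; intros HW h1 h2 HR HA; apply IHB, (HW h1 h2 HR), IHA, HA.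
Qed.

(** * Nodes of the refutation search *)

(** Substitution in a constraint, generalised to arbitrary label maps, since a branch composes many
    substitutions. *)
Definition cmap (f : label -> label) (r : constr) : constr :=
  match r with
  | Rel a b c => Rel (f a) (f b) (f c)
  | Neq a b => Neq (f a) (f b)
  end.

Lemma substG_cmap y x G : substG y x G = map (cmap (subst_label y x)) G.
Proof. apply map_ext. now intros []. Qed.

(* [nL] and [nR] record every labelled formula that has occurred on the left,
   resp. right, of the sequents on the branch, including those consumed by a
   rule application. *)
Record node (Var : Type) : Type := Node {
  nG : list constr;
  nL : list (lformula Var);
  nR : list (lformula Var)
}.

Definition node_labels (Var : Type) (N : node Var) : list label :=
  Eps :: flat_map constr_labels (nG N) ++ map fst (nL N) ++ map fst (nR N).

(* The formulae for which this is [False] by default are never consumed. *)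
Definition left_done (Var : Type) (N : node Var) (a : label)
    (A : formula Var) : Prop :=
  match A with
  | FAnd A B => In (a, A) (nL N) /\ In (a, B) (nL N)
  | FImp A B => In (a, A) (nR N) \/ In (a, B) (nL N)
  | FEmp => In (Rel Eps a Eps) (nG N)
  | FStar A B => exists x y,
      In (Rel x y a) (nG N) /\ In (x, A) (nL N) /\ In (y, B) (nL N)
  | _ => False
  end.

Definition right_done (Var : Type) (N : node Var) (a : label)
    (A : formula Var) : Prop :=
  match A with
  | FAnd A B => In (a, A) (nR N) \/ In (a, B) (nR N)
  | FImp A B => In (a, A) (nL N) /\ In (a, B) (nR N)
  | FWand A B => exists x y,
      In (Rel x a y) (nG N) /\ In (x, A) (nL N) /\ In (y, B) (nR N)
  | _ => False
  end.

(** [Gam] and [Del] form the sequent actually reached behind the record [N]. It has no cut-free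
    derivation, and a recorded formula missing from it has had its rule applied with the outcome
    recorded. *)
Definition coherent (Var : Type) (N : node Var)
    (Gam Del : list (lformula Var)) : Prop :=
  ~ derivable false (nG N) Gam Del /\
  (forall a A, In (a, A) (nL N) -> In (a, A) Gam \/ left_done N a A) /\
  (forall a A, In (a, A) (nR N) -> In (a, A) Del \/ right_done N a A).

Definition consistent (Var : Type) (N : node Var) : Prop :=
  exists Gam Del, coherent N Gam Del.

(** A morphism of nodes: whatever is recorded survives relabelling, so statements built positively
    from membership persist along it. *)
Definition ext (Var : Type) (f : label -> label) (N N' : node Var) : Prop :=
  f Eps = Eps /\
  (forall r, In r (nG N) -> In (cmap f r) (nG N')) /\
  (forall a A, In (a, A) (nL N) -> In (f a, A) (nL N')) /\
  (forall a A, In (a, A) (nR N) -> In (f a, A) (nR N')).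

Lemma ext_refl (Var : Type) (N : node Var) : ext (fun a => a) N N.
Proof. repeat split; auto. now intros []. Qed.

Lemma ext_trans (Var : Type) f g (N N' N'' : node Var) :
  ext f N N' -> ext g N' N'' -> ext (fun a => g (f a)) N N''.
Proof.
  intros (H1 & H2 & H3 & H4) (K1 & K2 & K3 & K4). repeat split; auto.
  - now rewrite H1.
  - intros r Hr. specialize (K2 _ (H2 _ Hr)). now destruct r.
Qed.

Lemma ext_rel (Var : Type) f (N N' : node Var) a b c :
  ext f N N' -> In (Rel a b c) (nG N) -> In (Rel (f a) (f b) (f c)) (nG N').
Proof. intros (_ & H & _) Hr. exact (H _ Hr). Qed.

Lemma ext_neq (Var : Type) f (N N' : node Var) a b :
  ext f N N' -> In (Neq a b) (nG N) -> In (Neq (f a) (f b)) (nG N').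
Proof. intros (_ & H & _) Hr. exact (H _ Hr). Qed.

Lemma ext_labels (Var : Type) f (N N' : node Var) a :
  ext f N N' -> In a (node_labels N) -> In (f a) (node_labels N').
Proof.
  intros (He & HG & HL & HR). unfold node_labels. simpl.
  rewrite !in_app_iff, !in_flat_map, !in_map_iff.
  intros [<-|[(r & Hr & Ha)|[((b & A) & <- & HA)|((b & A) & <- & HA)]]].
  - now left.
  - right. left. exists (cmap f r). split; [auto|].
    destruct r; simpl in *; intuition (subst; auto).
  - right. right. left. exists (f b, A). auto.
  - right. right. right. exists (f b, A). auto.
Qed.

Lemma left_done_ext (Var : Type) f (N N' : node Var) a A :
  ext f N N' -> left_done N a A -> left_done N' (f a) A.
Proof.
  intros He. pose proof He as (H0 & H1 & H2 & H3).
  destruct A; simpl; auto.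
  - intros []; auto.
  - intros []; auto.
  - intros Hr. apply (ext_rel _ _ _ He) in Hr. now rewrite H0 in Hr.
  - intros (x & y & Hr & HA & HB). exists (f x), (f y).
    apply (ext_rel _ _ _ He) in Hr. auto.
Qed.

Lemma right_done_ext (Var : Type) f (N N' : node Var) a A :
  ext f N N' -> right_done N a A -> right_done N' (f a) A.
Proof.
  intros He. pose proof He as (H0 & H1 & H2 & H3).
  destruct A; simpl; auto.
  - intros []; auto.
  - intros []; auto.
  - intros (x & y & Hr & HA & HB). exists (f x), (f y).
    apply (ext_rel _ _ _ He) in Hr. auto.
Qed.

Definition grow (Var : Type) (N : node Var) gs ls rs : node Var :=
  Node (gs ++ nG N) (ls ++ nL N) (rs ++ nR N).

Lemma ext_grow (Var : Type) (N : node Var) gs ls rs :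
  ext (fun a => a) N (grow N gs ls rs).
Proof.
  repeat split; simpl; intros; try (apply in_or_app; auto).
  now destruct r; right.
Qed.

(** A rule read backwards: [gs], [ls], [rs] are what the premise adds, [Gam'] and [Del'] what it
    retains. A dropped formula has to be done in the grown node. *)
Lemma coherent_grow (Var : Type) (N : node Var) Gam Del Gam' Del' gs ls rs :
  coherent N Gam Del ->
  (forall a A, In (a, A) Gam ->
    In (a, A) Gam' \/ left_done (grow N gs ls rs) a A) ->
  (forall a A, In (a, A) Del ->
    In (a, A) Del' \/ right_done (grow N gs ls rs) a A) ->
  ~ derivable false (gs ++ nG N) (ls ++ Gam') (rs ++ Del') ->
  coherent (grow N gs ls rs) (ls ++ Gam') (rs ++ Del').
Proof.
  intros (Hnd & HL & HR) HGam HDel Hnd'.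
  split; [exact Hnd'|split]; simpl; intros a A Ha;
    rewrite in_app_iff in Ha |- *; destruct Ha as [Ha|Ha]; auto.
  - destruct (HL a A Ha) as [H|H].
    + destruct (HGam a A H); auto.
    + right. exact (left_done_ext _ _ (ext_grow N gs ls rs) H).
  - destruct (HR a A Ha) as [H|H].
    + destruct (HDel a A H); auto.
    + right. exact (right_done_ext _ _ (ext_grow N gs ls rs) H).
Qed.

(** [c] is the atom that the premise of a merging rule keeps outside the substitution. *)
Definition subst_node (Var : Type) (c : constr) (y : label) (x : lvar)
    (N : node Var) : node Var :=
  Node (c :: substG y x (nG N)) (substL y x (nL N)) (substL y x (nR N)).

Lemma in_substL (Var : Type) y x (l : list (lformula Var)) a A :
  In (a, A) l -> In (subst_label y x a, A) (substL y x l).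
Proof.
  intros H. exact (in_map (fun aA => (subst_label y x (fst aA), snd aA)) _ _ H).
Qed.

Lemma ext_subst (Var : Type) c y x (N : node Var) :
  ext (subst_label y x) N (subst_node c y x N).
Proof.
  repeat split; simpl; auto using in_substL.
  intros r Hr. right. rewrite substG_cmap. now apply in_map.
Qed.

Lemma coherent_subst (Var : Type) (N : node Var) Gam Del c y x :
  coherent N Gam Del ->
  ~ derivable false (c :: substG y x (nG N)) (substL y x Gam) (substL y x Del) ->
  coherent (subst_node c y x N) (substL y x Gam) (substL y x Del).
Proof.
  intros (Hnd & HL & HR) Hnd'. pose proof (ext_subst c y x N) as He.
  split; [exact Hnd'|split]; simpl; intros a A Ha;
    apply in_map_iff in Ha; destruct Ha as ((b & B) & [= <- <-] & Hb).
  - destruct (HL b B Hb) as [H|H].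
    + left. now apply in_substL.
    + right. exact (left_done_ext _ _ He H).
  - destruct (HR b B Hb) as [H|H].
    + left. now apply in_substL.
    + right. exact (right_done_ext _ _ He H).
Qed.

(** Constraints form a set, so principal atoms can be duplicated into the context. Rules are thus
    applied with all of [nG N] as context, and no premise loses an atom. *)
Lemma derivable_contract (Var : Type) cut P G (Gam Del : list (lformula Var)) :
  incl P G -> derivable cut (P ++ G) Gam Del -> derivable cut G Gam Del.
Proof.
  intros Hi. apply d_conv; auto.
  intro r. rewrite in_app_iff. specialize (Hi r). tauto.
Qed.

Lemma derivable_expand (Var : Type) cut Q P G (Gam Del : list (lformula Var)) :
  incl P G -> derivable cut (Q ++ G) Gam Del ->
  derivable cut (Q ++ P ++ G) Gam Del.
Proof.
  intros Hi. apply d_conv; auto.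
  intro r. rewrite !in_app_iff. specialize (Hi r). tauto.
Qed.

Lemma derivable_perm (Var : Type) cut G (Gam Gam' Del Del' : list (lformula Var)) :
  Permutation Gam Gam' -> Permutation Del Del' ->
  derivable cut G Gam Del -> derivable cut G Gam' Del'.
Proof. intros H1 H2. now apply d_conv. Qed.

(** Every number from a bound on is fresh, so consecutive numbers serve as distinct fresh
    variables. *)
Lemma fresh_exists (Var : Type) G (Gam Del : list (lformula Var)) :
  exists n, forall m, n <= m -> fresh m G Gam Del.
Proof.
  unfold fresh.
  induction (flat_map constr_labels G ++ map fst Gam ++ map fst Del)
    as [|a l (n & Hn)].
  - exists 0. auto.
  - destruct a as [|k].
    + exists n. intros m Hm [|H]; [discriminate|]. now apply (Hn m).
    + exists (n + S k). intros m Hm [[= ->]|H]; [lia|].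
      apply (Hn m); [lia|exact H].
Qed.

(** * Tasks *)

(* One constructor per kind of rule instance.  A rule with a substitution is
   [done] when the two labels it merges have become equal under the label map
   applied by [tmap]. *)
Inductive task (Var : Type) : Type :=
| TU (a : label)
| TEM (a : label)
| TE (x y z : label)
| TEq (y z : label)
| TA (x y z u v : label)
| TP (x y z w : label)
| TC (x y z w : label)
| TIU (x y : label)
| TD (x y : label)
| TS (z : label)
| TCS (x y z u v : label)
| TL (a : label) (A : formula Var)
| TR (a : label) (A : formula Var)
| TStarR (x y z : label) (A B : formula Var)
| TWandL (x y z : label) (A B : formula Var).

Definition tmap (Var : Type) (f : label -> label) (t : task Var) : task Var :=
  match t with
  | TU _ a => TU _ (f a)
  | TEM _ a => TEM _ (f a)
  | TE _ x y z => TE _ (f x) (f y) (f z)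
  | TEq _ y z => TEq _ (f y) (f z)
  | TA _ x y z u v => TA _ (f x) (f y) (f z) (f u) (f v)
  | TP _ x y z w => TP _ (f x) (f y) (f z) (f w)
  | TC _ x y z w => TC _ (f x) (f y) (f z) (f w)
  | TIU _ x y => TIU _ (f x) (f y)
  | TD _ x y => TD _ (f x) (f y)
  | TS _ z => TS _ (f z)
  | TCS _ x y z u v => TCS _ (f x) (f y) (f z) (f u) (f v)
  | TL a A => TL (f a) A
  | TR a A => TR (f a) A
  | TStarR x y z A B => TStarR (f x) (f y) (f z) A B
  | TWandL x y z A B => TWandL (f x) (f y) (f z) A B
  end.

Definition enabled (Var : Type) (t : task Var) (N : node Var) : Prop :=
  match t with
  | TU _ a | TEM _ a => In a (node_labels N)
  | TE _ x y z => In (Rel x y z) (nG N)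
  | TEq _ y z => In (Rel Eps y z) (nG N)
  | TA _ x y z u v => In (Rel x y z) (nG N) /\ In (Rel u v x) (nG N)
  | TP _ x y z w => In (Rel x y z) (nG N) /\ In (Rel x y w) (nG N)
  | TC _ x y z w => In (Rel x y z) (nG N) /\ In (Rel x w z) (nG N)
  | TIU _ x y => In (Rel x y Eps) (nG N)
  | TD _ x y => In (Rel x x y) (nG N)
  | TS _ z => In (Neq z Eps) (nG N)
  | TCS _ x y z u v => In (Rel x y z) (nG N) /\ In (Rel u v z) (nG N)
  | TL a A => In (a, A) (nL N)
  | TR a A => In (a, A) (nR N)
  | TStarR x y z A B => In (Rel x y z) (nG N) /\ In (z, FStar A B) (nR N)
  | TWandL x y z A B => In (Rel x y z) (nG N) /\ In (y, FWand A B) (nL N)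
  end.

(** Formulae that stay in the antecedent: their left rule is an axiom, retains its principal
    formula, or does not exist. *)
Definition keptL (Var : Type) (A : formula Var) : Prop :=
  match A with
  | FAnd _ _ | FImp _ _ | FEmp | FStar _ _ => False
  | _ => True
  end.

Definition keptR (Var : Type) (A : formula Var) : Prop :=
  match A with
  | FAnd _ _ | FImp _ _ | FWand _ _ => False
  | _ => True
  end.

Definition done (Var : Type) (t : task Var) (N : node Var) : Prop :=
  match t with
  | TU _ a => In (Rel a Eps a) (nG N)
  | TEM _ a => In (Neq a Eps) (nG N) \/ In (Rel Eps a Eps) (nG N)
  | TE _ x y z => In (Rel y x z) (nG N)
  | TEq _ y z => y = z
  | TA _ x y z u v =>
      exists w, In (Rel u w z) (nG N) /\ In (Rel y v w) (nG N)
  | TP _ x y z w => z = w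
  | TC _ x y z w => y = w
  | TIU _ x y => x = Eps
  | TD _ x y => x = Eps
  | TS _ z => exists x y, In (Rel x y z) (nG N) /\
      In (Neq x Eps) (nG N) /\ In (Neq y Eps) (nG N)
  | TCS _ x y z u v => exists p q s t,
      In (Rel p q x) (nG N) /\ In (Rel p s u) (nG N) /\
      In (Rel s t y) (nG N) /\ In (Rel q t v) (nG N)
  | TL a A => keptL A \/ left_done N a A
  | TR a A => keptR A \/ right_done N a A
  | TStarR x y z A B => In (x, A) (nR N) \/ In (y, B) (nR N)
  | TWandL x y z A B => In (x, A) (nR N) \/ In (z, B) (nL N)
  end.

Lemma enabled_ext (Var : Type) f (N N' : node Var) t :
  ext f N N' -> enabled t N -> enabled (tmap f t) N'.
Proof.
  intros He. pose proof He as (H0 & H1 & H2 & H3).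
  destruct t; cbn [tmap enabled]; try (intros (Ha & Hb)); try intros Ha;
    eauto using ext_rel, ext_neq, ext_labels.
  (* The remaining tasks name the unit explicitly, and [f] fixes it. *)
  - rewrite <- H0. eauto using ext_rel.
  - rewrite <- H0. eauto using ext_rel.
  - rewrite <- H0. eauto using ext_neq.
Qed.

Lemma done_ext (Var : Type) f (N N' : node Var) t :
  ext f N N' -> done t N -> done (tmap f t) N'.
Proof.
  intros He. pose proof He as (H0 & H1 & H2 & H3).
  destruct t; simpl.
  - intro Ha. rewrite <- H0. eauto using ext_rel.
  - intros []; [left|right]; rewrite <- H0; eauto using ext_neq, ext_rel.
  - eauto using ext_rel.
  - congruence.
  - intros (w & Hw1 & Hw2). exists (f w). eauto using ext_rel.
  - congruence.
  - congruence.
  - congruence.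
  - congruence.
  - intros (x & y & Hr & Hx & Hy). exists (f x), (f y). rewrite <- H0.
    eauto 10 using ext_rel, ext_neq.
  - intros (p & q & s & t & Hp & Hq & Hs & Ht). exists (f p), (f q), (f s), (f t).
    eauto 10 using ext_rel.
  - intros []; eauto using left_done_ext.
  - intros []; eauto using right_done_ext.
  - intros []; auto.
  - intros []; auto.
Qed.

(** * Enabled tasks can be achieved at consistent nodes *)

Definition achievable (Var : Type) (N : node Var) (t : task Var) : Prop :=
  exists f N', ext f N N' /\ consistent N' /\ done (tmap f t) N'.

Lemma tmap_id (Var : Type) (t : task Var) : tmap (fun a => a) t = t.
Proof. now destruct t. Qed.

(** The case of a rule without substitution: labels stay as they are and the node is enlarged. *)
Lemma achieve_grow (Var : Type) (N : node Var) Gam Del t Gam' Del' gs ls rs :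
  coherent N Gam Del ->
  (forall a A, In (a, A) Gam ->
    In (a, A) Gam' \/ left_done (grow N gs ls rs) a A) ->
  (forall a A, In (a, A) Del ->
    In (a, A) Del' \/ right_done (grow N gs ls rs) a A) ->
  ~ derivable false (gs ++ nG N) (ls ++ Gam') (rs ++ Del') ->
  done t (grow N gs ls rs) ->
  achievable N t.
Proof.
  intros Hc HG HD Hnd Ht. exists (fun a => a), (grow N gs ls rs).
  rewrite tmap_id. split; [apply ext_grow|]. split; [|exact Ht].
  exists (ls ++ Gam'), (rs ++ Del'). eapply coherent_grow; eauto.
Qed.

Lemma achieve_constrs (Var : Type) (N : node Var) Gam Del t gs :
  coherent N Gam Del ->
  (derivable false (gs ++ nG N) Gam Del -> derivable false (nG N) Gam Del) ->
  done t (grow N gs [] []) ->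
  achievable N t.
Proof.
  intros Hc Hd Ht.
  apply (@achieve_grow _ N Gam Del t Gam Del gs [] []); auto.
  intro H. apply (proj1 Hc). auto.
Qed.

Lemma achieve_done (Var : Type) (N : node Var) t :
  consistent N -> done t N -> achievable N t.
Proof.
  intros Hc Ht. exists (fun a => a), N. rewrite tmap_id. auto using ext_refl.
Qed.

(** Either the substitution leaves [y] alone, or [y] is the variable [x] and the substitution is the
    identity. *)
Lemma subst_unifies y x : subst_label y x y = subst_label y x (LV x).
Proof.
  simpl. rewrite Nat.eqb_refl. destruct y as [|n]; simpl; [reflexivity|].
  destruct (Nat.eqb_spec n x); congruence.
Qed.

(** The common core of the merging rules. Only label variables may be replaced, so the side to
    replace depends on which of [a] and [b] is one; two units agree already. The atom [c] is left
    open because it differs from rule to rule. *)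
Lemma unify (Var : Type) (N : node Var) Gam Del a b :
  coherent N Gam Del ->
  (forall n, b = LV n -> exists c,
    derivable false (c :: substG a n (nG N)) (substL a n Gam) (substL a n Del) ->
    derivable false (nG N) Gam Del) ->
  (forall n, a = LV n -> exists c,
    derivable false (c :: substG b n (nG N)) (substL b n Gam) (substL b n Del) ->
    derivable false (nG N) Gam Del) ->
  exists f N', ext f N N' /\ consistent N' /\ f a = f b.
Proof.
  intros Hc Hb Ha. pose proof (proj1 Hc) as Hnd.
  destruct b as [|n].
  - destruct a as [|n].
    + exists (fun a => a), N. split; [apply ext_refl|]. split; [|reflexivity].
      now exists Gam, Del.
    + destruct (Ha n eq_refl) as (c & Hd).
      exists (subst_label Eps n), (subst_node c Eps n N).
      split; [apply ext_subst|]. split; [|symmetry; apply subst_unifies].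
      exists (substL Eps n Gam), (substL Eps n Del).
      apply coherent_subst; auto.
  - destruct (Hb n eq_refl) as (c & Hd).
    exists (subst_label a n), (subst_node c a n N).
    split; [apply ext_subst|]. split; [|apply subst_unifies].
    exists (substL a n Gam), (substL a n Del).
    apply coherent_subst; auto.
Qed.

Ltac incl_tac := intros r Hr; simpl in Hr; intuition (subst; auto).

Lemma achieve_rel (Var : Type) (N : node Var) t :
  consistent N -> enabled t N ->
  match t with
  | TL _ _ | TR _ _ | TStarR _ _ _ _ _ | TWandL _ _ _ _ _ => False
  | _ => True
  end -> achievable N t.
Proof.
  intros (Gam & Del & Hc) Hen Hk.
  destruct t; simpl in Hen; try contradiction; clear Hk.
  - apply (@achieve_constrs _ N Gam Del _ [Rel a Eps a] Hc); [|now left].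
    intro H. now apply d_U with (x := a).
  (* At least one premise of $EM$ is underivable, and the new node follows it. *)
  - destruct (classic (derivable false (Neq a Eps :: nG N) Gam Del)) as [H1|H1].
    + apply (@achieve_constrs _ N Gam Del _ [Rel Eps a Eps] Hc); [|right; now left].
      intro H. now apply d_EM with (w := a).
    + apply (@achieve_constrs _ N Gam Del _ [Neq a Eps] Hc); [|left; now left].
      contradiction.
  - apply (@achieve_constrs _ N Gam Del _ [Rel y x z] Hc); [|now left].
    intro H. apply (derivable_contract (P := [Rel x y z])); [incl_tac|].
    apply d_E. apply (derivable_expand [_] (P := [_])); [incl_tac|exact H].
  - edestruct (@unify _ N Gam Del y z Hc) as (f & N' & He & HN & Hf).
    + intros n ->. exists (Rel Eps y y). intro H.
      apply (derivable_contract (P := [Rel Eps y (LV n)])); [incl_tac|].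
      now apply d_Eq2.
    + intros n ->. exists (Rel Eps z z). intro H.
      apply (derivable_contract (P := [Rel Eps (LV n) z])); [incl_tac|].
      now apply d_Eq1.
    + exists f, N'. auto.
  - destruct Hen as (H1 & H2).
    set (P := [Rel x y z; Rel u v x]).
    assert (HP : incl P (nG N)) by (unfold P; incl_tac).
    destruct (fresh_exists (P ++ nG N) Gam Del) as (w & Hw).
    apply (@achieve_constrs _ N Gam Del _ [Rel u (LV w) z; Rel y v (LV w)] Hc).
    + intro H. apply (derivable_contract HP).
      apply (d_A (Hw w (le_n _))).
      now apply (derivable_expand [_; _] HP).
    + exists (LV w). simpl. auto.
  - destruct Hen as (H1 & H2).
    edestruct (@unify _ N Gam Del z w Hc) as (f & N' & He & HN & Hf).
    + intros n ->. exists (Rel x y z). intro H.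
      apply (derivable_contract (P := [Rel x y z; Rel x y (LV n)])); [incl_tac|].
      now apply d_P.
    (* The roles of [z] and [w] are exchanged, because $P$ replaces the third label of its second
       atom. *)
    + intros n ->. exists (Rel x y w). intro H.
      apply (derivable_contract (P := [Rel x y w; Rel x y (LV n)])); [incl_tac|].
      now apply d_P.
    + exists f, N'. auto.
  - destruct Hen as (H1 & H2).
    edestruct (@unify _ N Gam Del y w Hc) as (f & N' & He & HN & Hf).
    + intros n ->. exists (Rel x y z). intro H.
      apply (derivable_contract (P := [Rel x y z; Rel x (LV n) z])); [incl_tac|].
      now apply d_C.
    + intros n ->. exists (Rel x w z). intro H.
      apply (derivable_contract (P := [Rel x w z; Rel x (LV n) z])); [incl_tac|].
      now apply d_C.
    + exists f, N'. auto.
  - edestruct (@unify _ N Gam Del x Eps Hc) as (f & N' & He & HN & Hf).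
    + discriminate.
    + intros n ->. exists (Rel Eps y Eps). intro H.
      apply (derivable_contract (P := [Rel (LV n) y Eps])); [incl_tac|].
      now apply d_IU.
    (* Since [f] fixes the unit, [f x = f Eps] becomes [f x = Eps]. *)
    + exists f, N'. rewrite (proj1 He) in Hf. auto.
  - edestruct (@unify _ N Gam Del x Eps Hc) as (f & N' & He & HN & Hf).
    + discriminate.
    + intros n ->. exists (Rel Eps Eps y). intro H.
      apply (derivable_contract (P := [Rel (LV n) (LV n) y])); [incl_tac|].
      now apply d_D.
    + exists f, N'. rewrite (proj1 He) in Hf. auto.
  - set (P := [Neq z Eps]).
    assert (HP : incl P (nG N)) by (unfold P; incl_tac).
    destruct (fresh_exists (P ++ nG N) Gam Del) as (x & Hx).
    apply (@achieve_constrs _ N Gam Del _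
      [Rel (LV x) (LV (S x)) z; Neq (LV x) Eps; Neq (LV (S x)) Eps] Hc).
    + intro H. apply (derivable_contract HP).
      apply (@d_S Var false (nG N) Gam Del x (S x)).
      * repeat constructor; simpl; lia.
      * intros n Hn. apply Hx. simpl in Hn. lia.
      * now apply (derivable_expand [_; _; _] HP).
    + exists (LV x), (LV (S x)). simpl. auto 10.
  - destruct Hen as (H1 & H2).
    set (P := [Rel x y z; Rel u v z]).
    assert (HP : incl P (nG N)) by (unfold P; incl_tac).
    destruct (fresh_exists (P ++ nG N) Gam Del) as (p & Hp).
    (* Four consecutive numbers, hence distinct, and all fresh. *)
    set (q := S p). set (s := S q). set (t := S s).
    apply (@achieve_constrs _ N Gam Del _
      [Rel (LV p) (LV q) x; Rel (LV p) (LV s) u;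
       Rel (LV s) (LV t) y; Rel (LV q) (LV t) v] Hc).
    + intro H. apply (derivable_contract HP).
      apply (@d_CS Var false (nG N) Gam Del x y z u v p q s t).
      * repeat constructor; simpl; lia.
      * intros n Hn. apply Hp. simpl in Hn. lia.
      * now apply (derivable_expand [_; _; _; _] HP).
    + exists (LV p), (LV q), (LV s), (LV t). simpl. auto 20.
Qed.

Lemma in_perm (T : Type) (a : T) l :
  In a l -> exists l', Permutation l (a :: l').
Proof.
  intros H. apply in_split in H. destruct H as (l1 & l2 & ->).
  exists (l1 ++ l2). symmetry. apply Permutation_middle.
Qed.

Lemma perm_cons_inv (Var : Type) (Gam Gam' : list (lformula Var)) a A
    (Q : label -> formula Var -> Prop) :
  Permutation Gam ((a, A) :: Gam') -> Q a A ->
  forall b B, In (b, B) Gam -> In (b, B) Gam' \/ Q b B.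
Proof.
  intros Hp HQ b B Hb. apply (Permutation_in _ Hp) in Hb.
  destruct Hb as [[= <- <-]|Hb]; auto.
Qed.

(** By coherence the formula is either done or still in the sequent. In the latter case, unless it
    is kept, one occurrence is removed, and its left rule read backwards has an underivable premise
    recording what [left_done] demands. *)
Lemma achieve_left (Var : Type) (N : node Var) a A :
  consistent N -> In (a, A) (nL N) -> achievable N (TL a A).
Proof.
  intros (Gam & Del & Hc) Hin. pose proof Hc as (Hnd & HL & _).
  destruct (HL a A Hin) as [HG|Hd].
  2:{ apply achieve_done; [now exists Gam, Del|now right]. }
  destruct (classic (keptL A)) as [Hk|Hk].
  { apply achieve_done; [now exists Gam, Del|now left]. }
  destruct (in_perm _ _ HG) as (Gam' & Hp).
  assert (Hnd' : ~ derivable false (nG N) ((a, A) :: Gam') Del).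
  { intro H. apply Hnd. revert H. now apply derivable_perm. }
  assert (key : forall gs ls rs, left_done (grow N gs ls rs) a A ->
    ~ derivable false (gs ++ nG N) (ls ++ Gam') (rs ++ Del) ->
    achievable N (TL a A)).
  { intros gs ls rs Hd H.
    apply (@achieve_grow _ N Gam Del _ Gam' Del gs ls rs Hc); auto.
    - now apply perm_cons_inv with (a := a) (A := A).
    - now right. }
  destruct A; simpl in Hk; try tauto; clear Hk.
  - apply (key [] [(a, A1); (a, A2)] []); [simpl; auto|].
    intro H. apply Hnd'. now apply d_andL.
  (* If the first premise of the left implication rule is derivable, the second is not. *)
  - destruct (classic (derivable false (nG N) Gam' ((a, A1) :: Del))) as [H1|H1].
    + apply (key [] [(a, A2)] []); [simpl; auto|].
      intro H. apply Hnd'. now apply d_impL.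
    + apply (key [] [] [(a, A1)]); [simpl; auto|exact H1].
  - apply (key [Rel Eps a Eps] [] []); [simpl; auto|].
    intro H. apply Hnd'. now apply d_empL.
  - destruct (fresh_exists (nG N) ((a, FStar A1 A2) :: Gam') Del) as (x & Hx).
    apply (key [Rel (LV x) (LV (S x)) a] [(LV x, A1); (LV (S x), A2)] []).
    + exists (LV x), (LV (S x)). simpl. auto 10.
    + intro H. apply Hnd'. apply (@d_starL _ false _ _ _ x (S x)).
      * repeat constructor; simpl; lia.
      * intros n Hn. apply Hx. simpl in Hn. lia.
      * exact H.
Qed.

Lemma achieve_right (Var : Type) (N : node Var) a A :
  consistent N -> In (a, A) (nR N) -> achievable N (TR a A).
Proof.
  intros (Gam & Del & Hc) Hin. pose proof Hc as (Hnd & _ & HR).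
  destruct (HR a A Hin) as [HD|Hd].
  2:{ apply achieve_done; [now exists Gam, Del|now right]. }
  destruct (classic (keptR A)) as [Hk|Hk].
  { apply achieve_done; [now exists Gam, Del|now left]. }
  destruct (in_perm _ _ HD) as (Del' & Hp).
  assert (Hnd' : ~ derivable false (nG N) Gam ((a, A) :: Del')).
  { intro H. apply Hnd. revert H. now apply derivable_perm. }
  assert (key : forall gs ls rs, right_done (grow N gs ls rs) a A ->
    ~ derivable false (gs ++ nG N) (ls ++ Gam) (rs ++ Del') ->
    achievable N (TR a A)).
  { intros gs ls rs Hd H.
    apply (@achieve_grow _ N Gam Del _ Gam Del' gs ls rs Hc); auto.
    - now apply perm_cons_inv with (a := a) (A := A).
    - now right. }
  destruct A; simpl in Hk; try tauto; clear Hk.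
  - destruct (classic (derivable false (nG N) Gam ((a, A1) :: Del'))) as [H1|H1].
    + apply (key [] [] [(a, A2)]); [simpl; auto|].
      intro H. apply Hnd'. now apply d_andR.
    + apply (key [] [] [(a, A1)]); [simpl; auto|exact H1].
  - apply (key [] [(a, A1)] [(a, A2)]); [simpl; auto|].
    intro H. apply Hnd'. now apply d_impR.
  - destruct (fresh_exists (nG N) Gam ((a, FWand A1 A2) :: Del')) as (x & Hx).
    apply (key [Rel (LV x) a (LV (S x))] [(LV x, A1)] [(LV (S x), A2)]).
    + exists (LV x), (LV (S x)). simpl. auto 10.
    + intro H. apply Hnd'. apply (@d_wandR _ false _ _ _ x (S x)).
      * repeat constructor; simpl; lia.
      * intros n Hn. apply Hx. simpl in Hn. lia.
      * exact H.
Qed.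

(** If neither [x : A] nor [y : B] could be added on the right, both premises of $*R$ would be
    derivable, hence the sequent too. *)
Lemma achieve_starR (Var : Type) (N : node Var) x y z A B :
  consistent N -> In (Rel x y z) (nG N) -> In (z, FStar A B) (nR N) ->
  achievable N (TStarR x y z A B).
Proof.
  intros (Gam & Del & Hc) HG HD. pose proof Hc as (Hnd & _ & HR).
  (* [right_done] is false for a star, so the formula is still in [Del]. *)
  destruct (HR _ _ HD) as [Hin|[]].
  destruct (in_perm _ _ Hin) as (Del' & Hp).
  assert (HP : incl [Rel x y z] (nG N)) by incl_tac.
  assert (key : forall b C,
    ~ derivable false (nG N) Gam ((b, C) :: Del) ->
    (x, A) = (b, C) \/ (y, B) = (b, C) -> achievable N (TStarR x y z A B)).
  { intros b C H Hor.
    apply (@achieve_grow _ N Gam Del _ Gam Del [] [] [(b, C)] Hc); auto.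
    simpl. destruct Hor as [<-|<-]; auto. }
  destruct (classic (derivable false (nG N) Gam ((x, A) :: Del))) as [H1|H1];
    [|now apply (key x A); auto].
  destruct (classic (derivable false (nG N) Gam ((y, B) :: Del))) as [H2|H2];
    [|now apply (key y B); auto].
  destruct Hnd. apply (derivable_contract HP).
  apply (derivable_perm (Permutation_refl Gam) (Permutation_sym Hp)).
  apply d_starR; apply (derivable_expand [] HP);
    [revert H1|revert H2]; apply derivable_perm; auto.
Qed.

Lemma achieve_wandL (Var : Type) (N : node Var) x y z A B :
  consistent N -> In (Rel x y z) (nG N) -> In (y, FWand A B) (nL N) ->
  achievable N (TWandL x y z A B).
Proof.
  intros (Gam & Del & Hc) HG HD. pose proof Hc as (Hnd & HL & _).
  destruct (HL _ _ HD) as [Hin|[]].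
  destruct (in_perm _ _ Hin) as (Gam' & Hp).
  assert (HP : incl [Rel x y z] (nG N)) by incl_tac.
  destruct (classic (derivable false (nG N) Gam ((x, A) :: Del))) as [H1|H1].
  2:{ apply (@achieve_grow _ N Gam Del _ Gam Del [] [] [(x, A)] Hc); auto.
      simpl. auto. }
  destruct (classic (derivable false (nG N) ((z, B) :: Gam) Del)) as [H2|H2].
  2:{ apply (@achieve_grow _ N Gam Del _ Gam Del [] [(z, B)] [] Hc); auto.
      simpl. auto. }
  destruct Hnd. apply (derivable_contract HP).
  apply (derivable_perm (Permutation_sym Hp) (Permutation_refl Del)).
  apply d_wandL; apply (derivable_expand [] HP);
    [revert H1|revert H2]; apply derivable_perm; auto.
  rewrite Hp. apply perm_swap.
Qed.

Lemma achieve (Var : Type) (N : node Var) t :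
  consistent N -> enabled t N -> achievable N t.
Proof.
  intros Hc Hen. destruct t; try (now apply achieve_rel).
  - now apply achieve_left.
  - now apply achieve_right.
  - destruct Hen. now apply achieve_starR.
  - destruct Hen. now apply achieve_wandL.
Qed.

(** * Rounds of tasks and the saturating sequence *)

Definition all_tasks (Var : Type) (N : node Var) : list (task Var) :=
  map (TU Var) (node_labels N) ++ map (TEM Var) (node_labels N) ++
  flat_map (fun r => match r with
    | Rel x y z => [TE _ x y z; TEq _ y z; TIU _ x y; TD _ x z]
    | Neq z _ => [TS _ z]
    end) (nG N) ++
  flat_map (fun rr => match rr with
    | (Rel x y z, Rel u v w) =>
        [TA _ x y z u v; TP _ x y z w; TC _ x y z v; TCS _ x y z u v]
    | _ => []
    end) (list_prod (nG N) (nG N)) ++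
  map (fun aA => TL (fst aA) (snd aA)) (nL N) ++
  map (fun aA => TR (fst aA) (snd aA)) (nR N) ++
  flat_map (fun rA => match rA with
    | (Rel x y z, (_, FStar A B)) => [TStarR x y z A B]
    | _ => []
    end) (list_prod (nG N) (nR N)) ++
  flat_map (fun rA => match rA with
    | (Rel x y z, (_, FWand A B)) => [TWandL x y z A B]
    | _ => []
    end) (list_prod (nG N) (nL N)).

Lemma all_tasks_complete (Var : Type) (N : node Var) t :
  enabled t N -> In t (all_tasks N).
Proof.
  intro Hen. unfold all_tasks. rewrite !in_app_iff, !in_flat_map, !in_map_iff.
  destruct t; simpl in Hen; try destruct Hen as (H1 & H2).
  - left. eauto.
  - right; left. eauto.
  - do 2 right; left. eexists. split; [exact Hen|]. simpl; auto.
  - do 2 right; left. eexists. split; [exact Hen|]. simpl; auto.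
  - do 3 right; left. eexists. split; [exact (in_prod _ _ _ _ H1 H2)|]. simpl; auto.
  - do 3 right; left. eexists. split; [exact (in_prod _ _ _ _ H1 H2)|]. simpl; auto.
  - do 3 right; left. eexists. split; [exact (in_prod _ _ _ _ H1 H2)|]. simpl; auto.
  - do 2 right; left. eexists. split; [exact Hen|]. simpl; auto.
  - do 2 right; left. eexists. split; [exact Hen|]. simpl; auto.
  - do 2 right; left. eexists. split; [exact Hen|]. simpl; auto.
  - do 3 right; left. eexists. split; [exact (in_prod _ _ _ _ H1 H2)|]. simpl; auto.
  - do 4 right; left. exists (a, A). auto.
  - do 5 right; left. exists (a, A). auto.
  - do 6 right; left. eexists. split; [exact (in_prod _ _ _ _ H1 H2)|]. simpl; auto.
  - do 7 right. eexists. split; [exact (in_prod _ _ _ _ H1 H2)|]. simpl; auto.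
Qed.

(** Tasks are treated one by one: a task stays enabled until its turn comes, and once done it stays
    done. *)
Lemma achieve_list (Var : Type) (N : node Var) (ts : list (task Var)) :
  consistent N ->
  exists f N', ext f N N' /\ consistent N' /\
    forall t, In t ts -> enabled t N -> done (tmap f t) N'.
Proof.
  intros Hc. induction ts as [|t ts (f & N' & He & Hc' & Hts)].
  - exists (fun a => a), N. split; [apply ext_refl|]. split; [exact Hc|]. intros t [].
  (* The list may hold tasks that are not enabled at [N]; these are passed over. *)
  - destruct (classic (enabled t N)) as [Hen|Hen].
    + destruct (achieve _ Hc' (enabled_ext _ He Hen))
        as (g & N'' & He' & Hc'' & Hd).
      exists (fun a => g (f a)), N''.
      split; [eapply ext_trans; eauto|]. split; [exact Hc''|].
      assert (Hcomp : forall t' : task Var,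
        tmap (fun a => g (f a)) t' = tmap g (tmap f t'))
        by now intros [].
      intros t' [<-|Ht'] Hen'; rewrite Hcomp; [exact Hd|].
      apply (done_ext _ He'). auto.
    + exists f, N'. split; [exact He|]. split; [exact Hc'|].
      intros t' [<-|Ht'] Hen'; [contradiction|auto].
Qed.

Lemma achieve_all (Var : Type) (N : node Var) :
  consistent N ->
  exists f N', ext f N N' /\ consistent N' /\
    forall t, enabled t N -> done (tmap f t) N'.
Proof.
  intros Hc. destruct (achieve_list (all_tasks N) Hc) as (f & N' & He & Hc' & H).
  exists f, N'. auto using all_tasks_complete.
Qed.

(** Rounds are iterated by choice over the consistent nodes. A task that arises during a round waits
    for the next one. *)
Lemma saturating_sequence (Var : Type) (N0 : node Var) :
  consistent N0 ->
  exists (N : nat -> node Var) (f : nat -> label -> label),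
    N 0 = N0 /\
    forall n, consistent (N n) /\ ext (f n) (N n) (N (S n)) /\
      forall t, enabled t (N n) -> done (tmap (f n) t) (N (S n)).
Proof.
  intros Hc0.
  assert (Hstep : forall M : {N : node Var | consistent N},
    exists p : (label -> label) * {N : node Var | consistent N},
      ext (fst p) (proj1_sig M) (proj1_sig (snd p)) /\
      forall t, enabled t (proj1_sig M) ->
        done (tmap (fst p) t) (proj1_sig (snd p))).
  { intros (N & Hc). destruct (achieve_all Hc) as (f & N' & He & Hc' & Hd).
    now exists (f, exist _ N' Hc'). }
  set (next M := proj1_sig (constructive_indefinite_description _ (Hstep M))).
  set (sq := nat_rect (fun _ => {N : node Var | consistent N})
    (exist _ N0 Hc0) (fun _ M => snd (next M))).
  exists (fun n => proj1_sig (sq n)), (fun n => fst (next (sq n))).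
  split; [reflexivity|]. intro n. split; [exact (proj2_sig (sq n))|].
  exact (proj2_sig (constructive_indefinite_description _ (Hstep (sq n)))).
Qed.

(** * The limit of a saturating sequence *)

(** Worlds are equivalence classes, represented as predicates; extensionality and proof irrelevance
    turn equivalence into equality. Associativity is assumed in the form of rule $A$. *)
Lemma quotient_frame (X : Type) (eqv : X -> X -> Prop)
    (R0 : X -> X -> X -> Prop) (e : X) :
  (forall x, eqv x x) ->
  (forall x y, eqv x y -> eqv y x) ->
  (forall x y z, eqv x y -> eqv y z -> eqv x z) ->
  (forall x y z x' y' z', eqv x x' -> eqv y y' -> eqv z z' ->
    R0 x y z -> R0 x' y' z') ->
  (forall x y, R0 x e y <-> eqv x y) ->
  (forall x y z, R0 x y z -> R0 y x z) ->
  (forall x y z u v, R0 x y z -> R0 u v x -> exists w, R0 u w z /\ R0 y v w) ->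
  exists (M : bbi_frame) (pi : X -> M),
    pi e = eps /\ (forall h, exists x, h = pi x) /\
    (forall x y, pi x = pi y <-> eqv x y) /\
    (forall x y z, R (pi x) (pi y) (pi z) <-> R0 x y z).
Proof.
  intros Hrefl Hsym Htrans Hcong Hid Hcomm Hassoc.
  set (W := {P : X -> Prop | exists x, P = eqv x}).
  set (pi := fun x => exist _ (eqv x) (ex_intro _ x eq_refl) : W).
  assert (Hsurj : forall h : W, exists x, h = pi x).
  { intros (P & x & ->). now exists x. }
  assert (Hpi : forall x y, pi x = pi y <-> eqv x y).
  { intros x y. split.
    - intros H. apply (f_equal (@proj1_sig _ _)) in H. simpl in H.
      rewrite H. apply Hrefl.
    - intros H. apply eq_sig_hprop; [intros; apply proof_irrelevance|].
      apply functional_extensionality. intro z. apply propositional_extensionality.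
      split; intros Hz; [|now apply Htrans with y].
      apply Htrans with x; [now apply Hsym|exact Hz]. }
  set (RW := fun h1 h2 h3 : W => exists x y z,
    h1 = pi x /\ h2 = pi y /\ h3 = pi z /\ R0 x y z).
  assert (HR : forall x y z, RW (pi x) (pi y) (pi z) <-> R0 x y z).
  { intros x y z. split.
    - intros (x' & y' & z' & Hx & Hy & Hz & H).
      apply Hpi in Hx, Hy, Hz. eauto.
    - intros H. exists x, y, z. auto. }
  assert (HWid : forall h1 h2, RW h1 (pi e) h2 <-> h1 = h2).
  { intros h1 h2. destruct (Hsurj h1) as (x & ->), (Hsurj h2) as (y & ->).
    now rewrite HR, Hpi. }
  assert (HWcomm : forall h1 h2 h3, RW h1 h2 h3 <-> RW h2 h1 h3).
  { intros h1 h2 h3. destruct (Hsurj h1) as (x & ->), (Hsurj h2) as (y & ->),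
      (Hsurj h3) as (z & ->). rewrite !HR. split; apply Hcomm. }
  assert (HWassoc : forall h1 h2 h3 h4 h5, RW h1 h5 h4 -> RW h2 h3 h5 ->
    exists h6, RW h6 h3 h4 /\ RW h1 h2 h6).
  { intros h1 h2 h3 h4 h5.
    destruct (Hsurj h1) as (x1 & ->), (Hsurj h2) as (x2 & ->),
      (Hsurj h3) as (x3 & ->), (Hsurj h4) as (x4 & ->), (Hsurj h5) as (x5 & ->).
    rewrite !HR. intros H1 H2.
    (* Commuting both atoms brings frame associativity into the form of [Hassoc]. *)
    destruct (Hassoc x5 x1 x4 x3 x2 (Hcomm _ _ _ H1) (Hcomm _ _ _ H2))
      as (w & Hw1 & Hw2).
    exists (pi w). rewrite !HR. auto. }
  exists (Build_bbi_frame RW (pi e) HWid HWcomm HWassoc), pi.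
  repeat split; auto; first [apply Hpi | apply HR].
Qed.

Section Limit.

Context {Var : Type} (N : nat -> node Var) (f : nat -> label -> label).
Context (N_consistent : forall n, consistent (N n)).
Context (N_ext : forall n, ext (f n) (N n) (N (S n))).
Context (N_tasks :
  forall n t, enabled t (N n) -> done (tmap (f n) t) (N (S n))).

(* Transport from stage [i] to stage [j]; meaningful only for [i <= j]. *)
Fixpoint transport (i j : nat) (a : label) : label :=
  match j with
  | 0 => a
  | S j' => if Nat.leb i j' then f j' (transport i j' a) else a
  end.

Lemma transport_S i j a :
  i <= j -> transport i (S j) a = f j (transport i j a).
Proof. intros H. simpl. now apply Nat.leb_le in H as ->. Qed.

Lemma transport_id i a : transport i i a = a.
Proof.
  destruct i as [|i]; [reflexivity|]. cbn [transport].
  destruct (Nat.leb_spec (S i) i); [lia|reflexivity].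
Qed.

(* A label together with the stage at which it is read. *)
Definition point : Type := (nat * label)%type.

Definition at_stage (k : nat) (p : point) : label := transport (fst p) k (snd p).

Lemma at_stage_S k p : fst p <= k -> at_stage (S k) p = f k (at_stage k p).
Proof. apply transport_S. Qed.

Lemma at_stage_id k a : at_stage k (k, a) = a.
Proof. apply transport_id. Qed.

Definition origin : point := (0, Eps).

Lemma at_stage_origin k : at_stage k origin = Eps.
Proof.
  induction k as [|k IH]; [reflexivity|].
  rewrite at_stage_S by (simpl; lia). rewrite IH. apply N_ext.
Qed.

(** * Facts that hold from some stage on *)

Definition eventually (P : nat -> Prop) : Prop := exists k0, forall k, k0 <= k -> P k.

(** Label maps preserve every recorded fact, so one occurrence at a late enough stage makes it
    permanent. *)
Lemma eventually_step (P : nat -> Prop) k0 :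
  P k0 -> (forall k, k0 <= k -> P k -> P (S k)) -> eventually P.
Proof.
  intros H0 HS. exists k0. intros k Hk. induction Hk; auto.
Qed.

Definition elabel (p : point) : Prop :=
  eventually (fun k => In (at_stage k p) (node_labels (N k))).

Definition eeq (p q : point) : Prop :=
  eventually (fun k => at_stage k p = at_stage k q).

Definition erel (p q r : point) : Prop :=
  eventually (fun k =>
    In (Rel (at_stage k p) (at_stage k q) (at_stage k r)) (nG (N k))).

Definition eneq (p : point) : Prop :=
  eventually (fun k => In (Neq (at_stage k p) Eps) (nG (N k))).

Definition eleft (p : point) (A : formula Var) : Prop :=
  eventually (fun k => In (at_stage k p, A) (nL (N k))).

Definition eright (p : point) (A : formula Var) : Prop :=
  eventually (fun k => In (at_stage k p, A) (nR (N k))).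

(** Transport is meaningful only from the point's own stage on, hence the bound on [fst p], here and
    in the lemmas of the same shape below. *)
Lemma elabel_intro k p :
  fst p <= k -> In (at_stage k p) (node_labels (N k)) -> elabel p.
Proof.
  intros Hp H. apply eventually_step with k; [exact H|]. intros j Hj Hin.
  rewrite at_stage_S by lia. exact (ext_labels (N_ext j) Hin).
Qed.

Lemma eeq_intro k p q :
  fst p <= k -> fst q <= k -> at_stage k p = at_stage k q -> eeq p q.
Proof.
  intros Hp Hq H. apply eventually_step with k; [exact H|]. intros j Hj Heq.
  rewrite !at_stage_S by lia. now rewrite Heq.
Qed.

Lemma erel_intro k p q r :
  fst p <= k -> fst q <= k -> fst r <= k ->
  In (Rel (at_stage k p) (at_stage k q) (at_stage k r)) (nG (N k)) -> erel p q r.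
Proof.
  intros Hp Hq Hr H. apply eventually_step with k; [exact H|]. intros j Hj Hin.
  rewrite !at_stage_S by lia. exact (ext_rel _ _ _ (N_ext j) Hin).
Qed.

Lemma eneq_intro k p :
  fst p <= k -> In (Neq (at_stage k p) Eps) (nG (N k)) -> eneq p.
Proof.
  intros Hp H. apply eventually_step with k; [exact H|]. intros j Hj Hin.
  rewrite !at_stage_S by lia. apply (ext_neq _ _ (N_ext j)) in Hin.
  now rewrite (proj1 (N_ext j)) in Hin.
Qed.

Lemma eleft_intro k p A :
  fst p <= k -> In (at_stage k p, A) (nL (N k)) -> eleft p A.
Proof.
  intros Hp H. apply eventually_step with k; [exact H|]. intros j Hj Hin.
  rewrite !at_stage_S by lia. now apply (N_ext j).
Qed.

Lemma eright_intro k p A :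
  fst p <= k -> In (at_stage k p, A) (nR (N k)) -> eright p A.
Proof.
  intros Hp H. apply eventually_step with k; [exact H|]. intros j Hj Hin.
  rewrite !at_stage_S by lia. now apply (N_ext j).
Qed.

(** The bound [b] lets the common stage lie past the stages of all points involved; callers pass the
    sum of these stages. *)
Lemma eventually_common (P Q : nat -> Prop) (b : nat) :
  eventually P -> eventually Q -> exists k, b <= k /\ P k /\ Q k.
Proof.
  intros (k1 & H1) (k2 & H2). exists (b + k1 + k2). repeat split;
    [lia|apply H1; lia|apply H2; lia].
Qed.

Lemma eventually_at (P : nat -> Prop) (b : nat) :
  eventually P -> exists k, b <= k /\ P k.
Proof.
  intros (k1 & H1). exists (b + k1). split; [lia|apply H1; lia].
Qed.

Lemma eeq_refl p : eeq p p.
Proof. now exists 0. Qed.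

Lemma eeq_sym p q : eeq p q -> eeq q p.
Proof. intros (k & H). exists k. intros j Hj. symmetry. auto. Qed.

Lemma eeq_trans p q r : eeq p q -> eeq q r -> eeq p r.
Proof.
  intros (k & H) (k' & H'). exists (k + k'). intros j Hj.
  rewrite H by lia. apply H'. lia.
Qed.

Lemma erel_eeq p q r p' q' r' :
  eeq p p' -> eeq q q' -> eeq r r' -> erel p q r -> erel p' q' r'.
Proof.
  intros (k1 & H1) (k2 & H2) (k3 & H3) (k & H). exists (k1 + k2 + k3 + k).
  intros j Hj. rewrite <- H1, <- H2, <- H3 by lia. apply H. lia.
Qed.

Lemma eleft_eeq p p' A : eeq p p' -> eleft p A -> eleft p' A.
Proof.
  intros (k1 & H1) (k & H). exists (k1 + k). intros j Hj.
  rewrite <- H1 by lia. apply H. lia.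
Qed.

Lemma erel_labels p q r : erel p q r -> elabel p /\ elabel q /\ elabel r.
Proof.
  intros (k & H). repeat split; exists k; intros j Hj; specialize (H j Hj);
    right; apply in_or_app; left; apply in_flat_map;
    eexists; (split; [exact H|simpl; auto]).
Qed.

Lemma eleft_label p A : eleft p A -> elabel p.
Proof.
  intros (k & H). exists k. intros j Hj. right.
  apply in_or_app; right. apply in_or_app; left.
  exact (in_map fst _ _ (H j Hj)).
Qed.

Lemma eright_label p A : eright p A -> elabel p.
Proof.
  intros (k & H). exists k. intros j Hj. right.
  apply in_or_app; right. apply in_or_app; right.
  exact (in_map fst _ _ (H j Hj)).
Qed.

Lemma origin_label : elabel origin.
Proof. exists 0. intros k _. rewrite at_stage_origin. now left. Qed.

(** Reads the goal at stage [S k], where the tasks enabled at stage [k] are done: old labels are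
    moved by [f k], and witnesses are points of stage [S k]. *)
Ltac intro_at k :=
  first [apply elabel_intro with (S k) | apply eeq_intro with (S k)
    | apply erel_intro with (S k) | apply eneq_intro with (S k)
    | apply eleft_intro with (S k) | apply eright_intro with (S k)];
  try (simpl; lia);
  repeat match goal with
  | |- context [at_stage (S k) origin] => rewrite at_stage_origin
  | |- context [at_stage (S k) (S k, ?w)] => rewrite (at_stage_id (S k) w)
  end;
  rewrite ?at_stage_S by lia; auto.

(** * Frame and separation axioms for points *)

Lemma erel_comm p q r : erel p q r -> erel q p r.
Proof.
  intros H. destruct (eventually_at (fst p + fst q + fst r) H) as (k & Hk & Hr).
  pose proof (N_tasks k (TE _ _ _ _) Hr) as Hd. intro_at k.
Qed.

(** One direction comes from the $Eq$ rules, the other from $U$, whose task is enabled only for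
    labels that occur; hence [elabel p]. *)
Lemma erel_origin p q : elabel p -> (erel p origin q <-> eeq p q).
Proof.
  intros Hl. split.
  - intros H. apply erel_comm in H.
    destruct (eventually_at (fst p + fst q) H) as (k & Hk & Hr).
    rewrite at_stage_origin in Hr.
    pose proof (N_tasks k (TEq _ _ _) Hr) as Hd. intro_at k.
  - intros H. apply (erel_eeq (eeq_refl p) (eeq_refl origin) H).
    destruct (eventually_at (fst p) Hl) as (k & Hk & Hin).
    pose proof (N_tasks k (TU _ _) Hin) as Hd. intro_at k.
Qed.

Lemma erel_assoc x y z u v :
  erel x y z -> erel u v x -> exists w, erel u w z /\ erel y v w.
Proof.
  intros H1 H2.
  destruct (eventually_common (fst x + fst y + fst z + fst u + fst v) H1 H2)
    as (k & Hk & Hr1 & Hr2).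
  destruct (N_tasks k (TA _ _ _ _ _ _) (conj Hr1 Hr2)) as (w & Hw1 & Hw2).
  (* The label [w] is taken from the node at stage [S k], so it becomes a point of that stage. *)
  exists (S k, w). split; intro_at k.
Qed.

Lemma erel_deterministic x y z w : erel x y z -> erel x y w -> eeq z w.
Proof.
  intros H1 H2.
  destruct (eventually_common (fst x + fst y + fst z + fst w) H1 H2)
    as (k & Hk & Hr1 & Hr2).
  pose proof (N_tasks k (TP _ _ _ _ _) (conj Hr1 Hr2)) as Hd. intro_at k.
Qed.

Lemma erel_cancellative x y z w : erel x y z -> erel x w z -> eeq y w.
Proof.
  intros H1 H2.
  destruct (eventually_common (fst x + fst y + fst z + fst w) H1 H2)
    as (k & Hk & Hr1 & Hr2).
  pose proof (N_tasks k (TC _ _ _ _ _) (conj Hr1 Hr2)) as Hd. intro_at k.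
Qed.

Lemma erel_indivisible x y : erel x y origin -> eeq x origin.
Proof.
  intros H. destruct (eventually_at (fst x + fst y) H) as (k & Hk & Hr).
  rewrite at_stage_origin in Hr.
  pose proof (N_tasks k (TIU _ _ _) Hr) as Hd. intro_at k.
Qed.

Lemma erel_disjoint x y : erel x x y -> eeq x origin.
Proof.
  intros H. destruct (eventually_at (fst x + fst y) H) as (k & Hk & Hr).
  pose proof (N_tasks k (TD _ _ _) Hr) as Hd. intro_at k.
Qed.

Lemma erel_cross_split x y z u v :
  erel x y z -> erel u v z -> exists p q s t,
    erel p q x /\ erel p s u /\ erel s t y /\ erel q t v.
Proof.
  intros H1 H2.
  destruct (eventually_common (fst x + fst y + fst z + fst u + fst v) H1 H2)
    as (k & Hk & Hr1 & Hr2).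
  destruct (N_tasks k (TCS _ _ _ _ _ _) (conj Hr1 Hr2))
    as (p & q & s & t & Hp & Hq & Hs & Ht).
  exists (S k, p). exists (S k, q). exists (S k, s). exists (S k, t).
  repeat split; intro_at k.
Qed.

(** Otherwise some stage contains $\epsilon\neq\epsilon$, and $\neq L$ derives its sequent. *)
Lemma eneq_not_origin p : eneq p -> ~ eeq p origin.
Proof.
  intros H1 H2. destruct (eventually_common 0 H1 H2) as (k & _ & Hn & He).
  rewrite He, at_stage_origin in Hn.
  destruct (N_consistent k) as (Gam & Del & Hnd & _). apply Hnd.
  apply (derivable_contract (P := [Neq Eps Eps])); [|apply d_neqL].
  intros r [<-|[]]. exact Hn.
Qed.

Lemma eneq_or_origin p : elabel p -> eneq p \/ eeq p origin.
Proof.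
  intros H. destruct (eventually_at (fst p) H) as (k & Hk & Hin).
  destruct (N_tasks k (TEM _ _) Hin) as [Hd|Hd].
  - left. intro_at k.
  - right. apply erel_origin; [exact H|]. apply erel_comm. intro_at k.
Qed.

Lemma eneq_split z : eneq z -> exists x y, erel x y z /\ eneq x /\ eneq y.
Proof.
  intros H. destruct (eventually_at (fst z) H) as (k & Hk & Hin).
  destruct (N_tasks k (TS _ _) Hin) as (x & y & Hr & Hx & Hy).
  exists (S k, x). exists (S k, y). repeat split; intro_at k.
Qed.

(** * Labelled formulae at points *)

Lemma eleft_not_eright_var p v : eleft p (FVar v) -> eright p (FVar v) -> False.
Proof.
  intros H1 H2. destruct (eventually_common 0 H1 H2) as (k & _ & HL & HR).
  destruct (N_consistent k) as (Gam & Del & Hnd & HG & HD). apply Hnd.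
  (* A variable is never consumed, so both occurrences are in the sequent itself, which is then an
     instance of $id$. *)
  destruct (HG _ _ HL) as [HL'|[]]. destruct (HD _ _ HR) as [HR'|[]].
  destruct (in_perm _ _ HL') as (Gam' & HpG).
  destruct (in_perm _ _ HR') as (Del' & HpD).
  apply (derivable_perm (Permutation_sym HpG) (Permutation_sym HpD)), d_id.
Qed.

Lemma not_eleft_bot p : ~ eleft p FBot.
Proof.
  intros H. destruct (eventually_at 0 H) as (k & _ & HL).
  destruct (N_consistent k) as (Gam & Del & Hnd & HG & _). apply Hnd.
  destruct (HG _ _ HL) as [HL'|[]]. destruct (in_perm _ _ HL') as (Gam' & HpG).
  apply (derivable_perm (Permutation_sym HpG) (Permutation_refl _)), d_botL.
Qed.

Lemma not_eright_top p : ~ eright p FTop.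
Proof.
  intros H. destruct (eventually_at 0 H) as (k & _ & HR).
  destruct (N_consistent k) as (Gam & Del & Hnd & _ & HD). apply Hnd.
  destruct (HD _ _ HR) as [HR'|[]]. destruct (in_perm _ _ HR') as (Del' & HpD).
  apply (derivable_perm (Permutation_refl _) (Permutation_sym HpD)), d_topR.
Qed.

Lemma eright_emp p : eright p FEmp -> ~ eeq p origin.
Proof.
  intros H1 H2. destruct (eventually_common 0 H1 H2) as (k & _ & HR & He).
  rewrite He, at_stage_origin in HR.
  destruct (N_consistent k) as (Gam & Del & Hnd & _ & HD). apply Hnd.
  destruct (HD _ _ HR) as [HR'|[]]. destruct (in_perm _ _ HR') as (Del' & HpD).
  apply (derivable_perm (Permutation_refl _) (Permutation_sym HpD)), d_empR.
Qed.

Lemma eleft_emp p : eleft p FEmp -> eeq p origin.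
Proof.
  intros H. destruct (eventually_at (fst p) H) as (k & Hk & Hin).
  destruct (N_tasks k (TL _ _) Hin) as [[]|Hd]. simpl in Hd.
  apply erel_origin; [exact (eleft_label H)|]. apply erel_comm. intro_at k.
Qed.

Lemma eleft_and p A B : eleft p (FAnd A B) -> eleft p A /\ eleft p B.
Proof.
  intros H. destruct (eventually_at (fst p) H) as (k & Hk & Hin).
  destruct (N_tasks k (TL _ _) Hin) as [[]|(HA & HB)]. split; intro_at k.
Qed.

Lemma eright_and p A B : eright p (FAnd A B) -> eright p A \/ eright p B.
Proof.
  intros H. destruct (eventually_at (fst p) H) as (k & Hk & Hin).
  destruct (N_tasks k (TR _ _) Hin) as [[]|[HA|HB]]; [left|right]; intro_at k.
Qed.

Lemma eleft_imp p A B : eleft p (FImp A B) -> eright p A \/ eleft p B.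
Proof.
  intros H. destruct (eventually_at (fst p) H) as (k & Hk & Hin).
  destruct (N_tasks k (TL _ _) Hin) as [[]|[HA|HB]]; [left|right]; intro_at k.
Qed.

Lemma eright_imp p A B : eright p (FImp A B) -> eleft p A /\ eright p B.
Proof.
  intros H. destruct (eventually_at (fst p) H) as (k & Hk & Hin).
  destruct (N_tasks k (TR _ _) Hin) as [[]|(HA & HB)]. split; intro_at k.
Qed.

Lemma eleft_star p A B :
  eleft p (FStar A B) -> exists x y, erel x y p /\ eleft x A /\ eleft y B.
Proof.
  intros H. destruct (eventually_at (fst p) H) as (k & Hk & Hin).
  destruct (N_tasks k (TL _ _) Hin) as [[]|(x & y & Hr & HA & HB)].
  exists (S k, x). exists (S k, y). repeat split; intro_at k.
Qed.

Lemma eright_star x y z A B :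
  eright z (FStar A B) -> erel x y z -> eright x A \/ eright y B.
Proof.
  intros H1 H2.
  destruct (eventually_common (fst x + fst y + fst z) H1 H2)
    as (k & Hk & Hin & Hr).
  destruct (N_tasks k (TStarR _ _ _ _ _) (conj Hr Hin)) as [Hd|Hd];
    [left|right]; intro_at k.
Qed.

Lemma eleft_wand x y z A B :
  eleft y (FWand A B) -> erel x y z -> eright x A \/ eleft z B.
Proof.
  intros H1 H2.
  destruct (eventually_common (fst x + fst y + fst z) H1 H2)
    as (k & Hk & Hin & Hr).
  destruct (N_tasks k (TWandL _ _ _ _ _) (conj Hr Hin)) as [Hd|Hd];
    [left|right]; intro_at k.
Qed.

Lemma eright_wand p A B :
  eright p (FWand A B) -> exists x y, erel x p y /\ eleft x A /\ eright y B.
Proof.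
  intros H. destruct (eventually_at (fst p) H) as (k & Hk & Hin).
  destruct (N_tasks k (TR _ _) Hin) as [[]|(x & y & Hr & HA & HB)].
  exists (S k, x). exists (S k, y). repeat split; intro_at k.
Qed.

(** * The limit frame and the truth lemma *)

Definition limit_world : Type := {p : point | elabel p}.

Definition lift (p : point) (H : elabel p) : limit_world := exist _ p H.

(** The carrier consists of the points whose label eventually occurs in the nodes; for those,
    [erel_origin] gives the unit law. *)
Lemma limit_frame :
  exists (M : bbi_frame) (pi : limit_world -> M),
    pi (lift origin_label) = eps /\ (forall h, exists x, h = pi x) /\
    (forall x y, pi x = pi y <-> eeq (proj1_sig x) (proj1_sig y)) /\
    (forall x y z, R (pi x) (pi y) (pi z) <->
      erel (proj1_sig x) (proj1_sig y) (proj1_sig z)).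
Proof.
  apply (@quotient_frame limit_world
    (fun x y => eeq (proj1_sig x) (proj1_sig y))
    (fun x y z => erel (proj1_sig x) (proj1_sig y) (proj1_sig z))
    (lift origin_label)).
  - intros x. apply eeq_refl.
  - intros x y. apply eeq_sym.
  - intros x y z. apply eeq_trans.
  - intros x y z x' y' z'. apply erel_eeq.
  - intros x y. apply erel_origin. exact (proj2_sig x).
  - intros x y z. apply erel_comm.
  - intros x y z u v H1 H2. destruct (erel_assoc H1 H2) as (w & Hw1 & Hw2).
    exists (lift (proj2 (proj2 (erel_labels Hw2)))). auto.
Qed.

(** The induction is on the original formula, while left and right membership concern its
    unabbreviated form; negation and disjunction are unfolded into the implications that encode
    them. *)
Lemma limit_model :
  exists (M : bbi_frame) (pi : limit_world -> M) (nu : Var -> M -> Prop),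
    separation_theory M /\
    forall A x,
      (eleft (proj1_sig x) (unabbrev A) -> forces M nu (pi x) A) /\
      (eright (proj1_sig x) (unabbrev A) -> ~ forces M nu (pi x) A).
Proof.
  destruct limit_frame as (M & pi & Heps & Hsurj & Heq & HR).
  (* A variable holds at a class when some representative has it eventually on the left. *)
  exists M, pi, (fun v h => exists x, h = pi x /\ eleft (proj1_sig x) (FVar v)).
  split.
  - repeat split; unfold cancellativity, partial_determinism, indivisible_unit,
      disjointness, splittability, cross_split.
    + intros h1 h2 h3 h4. destruct (Hsurj h1) as (x1 & ->),
        (Hsurj h2) as (x2 & ->), (Hsurj h3) as (x3 & ->), (Hsurj h4) as (x4 & ->).
      rewrite !HR, Heq. apply erel_cancellative.
    + intros h1 h2 h3 h4. destruct (Hsurj h1) as (x1 & ->),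
        (Hsurj h2) as (x2 & ->), (Hsurj h3) as (x3 & ->), (Hsurj h4) as (x4 & ->).
      rewrite !HR, Heq. apply erel_deterministic.
    + intros h1 h2. destruct (Hsurj h1) as (x1 & ->), (Hsurj h2) as (x2 & ->).
      rewrite <- Heps, HR, Heq. apply erel_indivisible.
    + intros h1 h2. destruct (Hsurj h1) as (x1 & ->), (Hsurj h2) as (x2 & ->).
      rewrite <- Heps, HR, Heq. apply erel_disjoint.
    (* A point other than the origin carries an inequality by $EM$, and $S$ then splits it. *)
    + intros h. destruct (Hsurj h) as (x & ->). rewrite <- Heps, Heq. intros Hx.
      destruct (eneq_or_origin (proj2_sig x)) as [Hn|]; [|contradiction].
      destruct (eneq_split Hn) as (y & z & Hr & Hy & Hz).
      destruct (erel_labels Hr) as (Hly & Hlz & _).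
      exists (pi (lift Hly)), (pi (lift Hlz)). rewrite !Heq, HR.
      split; [now apply eneq_not_origin|]. split; [now apply eneq_not_origin|].
      exact Hr.
    + intros h0 h1 h2 h3 h4. destruct (Hsurj h0) as (x0 & ->),
        (Hsurj h1) as (x1 & ->), (Hsurj h2) as (x2 & ->),
        (Hsurj h3) as (x3 & ->), (Hsurj h4) as (x4 & ->).
      rewrite !HR. intros H1 H2.
      destruct (erel_cross_split H1 H2) as (p & q & s & t & Hp & Hq & Hs & Ht).
      destruct (erel_labels Hp) as (Hlp & Hlq & _).
      destruct (erel_labels Hs) as (Hls & Hlt & _).
      exists (pi (lift Hlp)), (pi (lift Hlq)), (pi (lift Hls)), (pi (lift Hlt)).
      rewrite !HR. auto.
  - induction A as [v| | |A IHA|A IHA B IHB|A IHA B IHB|A IHA B IHB|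
      |A IHA B IHB|A IHA B IHB]; intro x; simpl.
    + split; [eauto|]. intros Hr (y & Hy & Hl). apply Heq, eeq_sym in Hy.
      exact (eleft_not_eright_var (eleft_eeq Hy Hl) Hr).
    + split; [auto|]. intros Hr. now apply not_eright_top in Hr.
    + split; [apply not_eleft_bot|auto].
    + split.
      * intros Hl. destruct (eleft_imp Hl) as [HA|HB]; [now apply IHA|].
        now apply not_eleft_bot in HB.
      * intros Hr Hn. destruct (eright_imp Hr) as (HA & _). now apply Hn, IHA.
    + split.
      * intros Hl. destruct (eleft_imp Hl) as [HA|HB].
        (* [HA] puts the negation of [A] on the right, hence [A] on the left. *)
        -- left. destruct (eright_imp HA) as (HA' & _). now apply IHA.
        -- right. now apply IHB.
      * intros Hr Hor. destruct (eright_imp Hr) as (HA & HB).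
        destruct Hor as [HA'|HB']; [|now apply (IHB x) in HB'].
        destruct (eleft_imp HA) as [HA''|HA''].
        -- now apply (IHA x) in HA'.
        -- now apply not_eleft_bot in HA''.
    + split.
      * intros Hl. destruct (eleft_and Hl). split; [now apply IHA|now apply IHB].
      * intros Hr (HA & HB). destruct (eright_and Hr) as [H|H].
        -- now apply (IHA x) in HA.
        -- now apply (IHB x) in HB.
    + split.
      * intros Hl HA. destruct (eleft_imp Hl) as [H|H].
        -- now apply (IHA x) in HA.
        -- now apply IHB.
      * intros Hr HAB. destruct (eright_imp Hr) as (HA & HB).
        apply (proj2 (IHB x) HB), HAB, IHA, HA.
    + rewrite <- Heps, Heq. split; [apply eleft_emp|apply eright_emp].
    + split.
      * intros Hl. destruct (eleft_star Hl) as (y & z & Hr & HA & HB).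
        exists (pi (lift (eleft_label HA))), (pi (lift (eleft_label HB))).
        rewrite HR. repeat split; [exact Hr|now apply IHA|now apply IHB].
      * intros Hr (h1 & h2 & HRel & HA & HB).
        destruct (Hsurj h1) as (y & ->), (Hsurj h2) as (z & ->).
        rewrite HR in HRel. destruct (eright_star Hr HRel) as [H|H].
        -- now apply (IHA y) in HA.
        -- now apply (IHB z) in HB.
    + split.
      * intros Hl h1 h2 HRel HA.
        destruct (Hsurj h1) as (y & ->), (Hsurj h2) as (z & ->).
        (* The left wand rule has the argument in first place, the forcing clause in second
           place. *)
        rewrite HR in HRel. apply erel_comm in HRel.
        destruct (eleft_wand Hl HRel) as [H|H].
        -- now apply (IHA y) in HA.
        -- now apply IHB.
      * intros Hr HW. destruct (eright_wand Hr) as (y & z & HRel & HA & HB).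
        apply (proj2 (IHB (lift (eright_label HB))) HB).
        apply (HW (pi (lift (eleft_label HA)))).
        -- rewrite HR. now apply erel_comm.
        -- now apply IHA.
Qed.

End Limit.

(** * Completeness without cut, and both directions together *)

Lemma cut_free_completeness (Var : Type) (F : formula Var) (w : label) :
  valid_over separation_theory F -> derivable false [] [] [(w, unabbrev F)].
Proof.
  intros Hv. apply NNPP. intros Hnd.
  assert (Hc : consistent (Node [] [] [(w, unabbrev F)])).
  { exists [], [(w, unabbrev F)]. split; [exact Hnd|]. simpl. auto. }
  destruct (saturating_sequence Hc) as (N & f & HN0 & HN).
  (* The root formula sits on the right at the point [(0, w)], so it fails there in the limit model,
     against validity. *)
  assert (Hin : In (at_stage f 0 (0, w), unabbrev F) (nR (N 0)))
    by (rewrite HN0; now left).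
  apply (@eright_intro _ N f (fun n => proj1 (proj2 (HN n))) 0 (0, w)) in Hin;
    [|apply le_n].
  destruct (@limit_model _ N f (fun n => proj1 (HN n))
    (fun n => proj1 (proj2 (HN n))) (fun n => proj2 (proj2 (HN n))))
    as (M & pi & nu & Hst & Hforce).
  apply (proj2 (Hforce F (exist _ (0, w) (eright_label Hin))) Hin).
  now apply Hv.
Qed.

Theorem mainTheorem13 (Var : Type) (F : formula Var) :
  ((exists w : lvar, derivable true [] [] [(LV w, unabbrev F)]) ->
     valid_over separation_theory F) /\
  (valid_over separation_theory F ->
     exists w : lvar, derivable false [] [] [(LV w, unabbrev F)]).
Proof.
  split.
  - intros (w & Hd) M HM nu h. apply forces_unabbrev.
    (* The constant valuation makes [w] denote the given world [h]. *)
    assert (HE : Exists (lsat nu (fun _ => h)) [(LV w, unabbrev F)])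
      by (apply (soundness HM Hd); constructor).
    now apply Exists_cons in HE as [HE|HE]; [|inversion HE].
  - intros Hv. exists 0. now apply cut_free_completeness.
Qed.
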